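(* Let $l\in\mathbb{Z}$ with $l\neq 0$, let $\alpha\in\mathbb{R}\setminus\mathbb{Q}$, let $f\in\mathcal{F}_l$, and let $T:\mathbb{T}^2\to\mathbb{T}^2$, $T(x,y)=(x+\alpha,f(x)+y)$. Then the following statements are equivalent: (1) $(\mathbb{T}^2,T)$ is a system of order $2$; (2) there exist $\varphi\in\mathcal{F}_0$ and $c\in\mathbb{R}$ such that $f(x)=lx+\varphi(x+\alpha)-\varphi(x)+c$ for every $x\in\mathbb{R}$.
   Context: $\mathbb{T}^1=\mathbb{R}/\mathbb{Z}$, $\mathbb{T}^2=\mathbb{T}^1\times\mathbb{T}^1$. For $l\in\mathbb{Z}$, $\mathcal{F}_l=\{h:\mathbb{R}\to\mathbb{R}: h\text{ continuous and } h(x+1)-h(x)=l\text{ for all }x\in\mathbb{R}\}$; for $f\in\mathcal{F}_l$ the value $f(x)$ mod $1$ is well defined for $x\in\mathbb{T}^1$. A topological dynamical system is a pair $(X,T)$ with $X$ a compact metric space and $T:X\to X$ a homeomorphism; it is minimal if every orbit is dense. If $G$ is a $d$-step nilpotent Lie group (i.e. $G_{d+1}$ is trivial, where $G_1=G$, $G_{j+1}=[G_j,G]$), $\Gamma$ is a discrete cocompact subgroup of $G$ and $\tau\in G$, then $X=G/\Gamma$ with the map $x\mapsto\tau x$ is called a $d$-step nilsystem. A minimal topological dynamical system is a system of order $d$ if it is an inverse limit of $d$-step nilsystems. *)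

(* Defs.v *)
From HB Require Import structures.
From mathcomp Require Import all_boot all_order all_algebra.
From mathcomp Require Import all_classical all_reals all_analysis.

Set Implicit Arguments.
Unset Strict Implicit.
Unset Printing Implicit Defensive.

Import Order.TTheory GRing.Theory Num.Theory.
Import numFieldNormedType.Exports.

Local Open Scope classical_set_scope.
Local Open Scope quotient_scope.
Local Open Scope ring_scope.

Definition homeomorphism (X Y : topologicalType) (h : X -> Y) : Prop :=
  continuous h /\
  exists g : Y -> X, [/\ cancel h g, cancel g h & continuous g].

Definition metrizable (R : realType) (X : topologicalType) : Prop :=
  exists (M : metricType R) (h : X -> M), homeomorphism h.

Definition tds (R : realType) (X : topologicalType) (T : X -> X) : Prop :=
  [/\ metrizable R X, compact [set: X] & homeomorphism T].

(* The orbit [{T^n x : n in Z}] of a bijection, without naming [T^-1]. *)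
Definition full_orbit (X : Type) (T : X -> X) (x : X) : set X :=
  [set y | exists n : nat, y = iter n T x \/ iter n T y = x].

Definition minimal (X : topologicalType) (T : X -> X) : Prop :=
  forall x : X, dense (full_orbit T x).

Definition factor_map (X Y : topologicalType) (T : X -> X) (S : Y -> Y)
    (p : X -> Y) : Prop :=
  [/\ continuous p, set_surj [set: X] [set: Y] p &
      forall x, p (T x) = S (p x)].

(* Used below as a type, with the subspace topology of the product topology. *)
Definition inverse_limit (X : nat -> topologicalType)
    (p : forall i, X i.+1 -> X i) : set (prod_topology X) :=
  [set x | forall i, p i (x i.+1) = x i].

(* [h] is a topological conjugacy between [(X, T)] and the inverse limit,
   on which the transformation acts coordinatewise. *)
Definition is_inverse_limit (X : topologicalType) (T : X -> X)
    (Y : nat -> topologicalType) (S : forall i, Y i -> Y i)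
    (p : forall i, Y i.+1 -> Y i) : Prop :=
  (forall i, factor_map (S i.+1) (S i) (p i)) /\
  exists h : X -> inverse_limit p,
    homeomorphism h /\
    forall (x : X) (i : nat), set_val (h (T x)) i = S i (set_val (h x) i).

Section Groups.
Local Open Scope group_scope.

Definition is_subgroup (G : groupType) (H : set G) : Prop :=
  [/\ H 1, forall x y, H x -> H y -> H (x * y) & forall x, H x -> H x^-1].

(* [lower_central j] is [G_(j+1)], so that index 0 is [G_1 = G]. *)
Fixpoint lower_central (G : groupType) (j : nat) : set G :=
  if j is j'.+1 then
    smallest (@is_subgroup G)
      [set [~ ab.1, ab.2] | ab in @lower_central G j' `*` [set: G]]
  else [set: G].

Definition nilpotent_step (G : groupType) (d : nat) : Prop :=
  @lower_central G d = [set 1].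

End Groups.

Record subgroup (G : groupType) := Subgroup {
  subgroup_set : set G;
  subgroupP : is_subgroup subgroup_set }.

HB.mixin Record isTopologicalGroup G & Group G & Topological G := {
  mulg_continuous : continuous (fun xy : G * G => (xy.1 * xy.2)%g);
  invg_continuous : continuous (fun x : G => (x^-1)%g) }.

#[short(type="topologicalGroupType")]
HB.structure Definition TopologicalGroup :=
  {G of Group G & Topological G & isTopologicalGroup G}.

(* [f] is of class C^k on the open set [U]. This is the usual notion for
   finite-dimensional [V], where it is enough to differentiate along all fixed
   directions [v] instead of considering the differential ['d f]. *)
Fixpoint class_C (R : realType) (V W : normedModType R) (k : nat)
    (U : set V) (f : V -> W) : Prop :=
  if k is k'.+1 then
    (forall x, U x -> differentiable f x) /\
    (forall v : V, class_C k' U ('D_v f))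
  else forall x, U x -> {for x, continuous f}.

Definition smooth (R : realType) (V W : normedModType R)
    (U : set V) (f : V -> W) : Prop :=
  forall k, class_C k U f.

(* [chart_map] and [chart_inv] are total functions, only meaningful on
   [chart_dom] and on its image. *)
Record chart (R : realType) (X : topologicalType) (n : nat) := Chart {
  chart_dom : set X;
  chart_map : X -> 'rV[R]_n;
  chart_inv : 'rV[R]_n -> X;
  chart_dom_open : open chart_dom;
  chart_cod_open : open (chart_map @` chart_dom);
  chart_mapK : {in chart_dom, cancel chart_map chart_inv};
  chart_map_continuous :
    forall x, chart_dom x -> {for x, continuous chart_map};
  chart_inv_continuous :
    forall v, (chart_map @` chart_dom) v -> {for v, continuous chart_inv} }.

Definition chart_cod (R : realType) (X : topologicalType) (n : nat)
    (c : chart R X n) : set 'rV[R]_n := chart_map c @` chart_dom c.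

(* Not assumed connected; [n = 0] (discrete groups) is allowed. *)
Definition lie_group (R : realType) (G : topologicalGroupType) : Prop :=
  [/\ hausdorff_space G, @second_countable G &
  exists (n : nat) (A : set (chart R G n)),
  [/\ forall g : G, exists2 a, A a & chart_dom a g,
      forall a b, A a -> A b ->
        smooth (chart_map a @` (chart_dom a `&` chart_dom b))
               (chart_map b \o chart_inv a),
      forall a b c, A a -> A b -> A c ->
        let m := fun uv : 'rV[R]_n * 'rV[R]_n =>
                   (chart_inv a uv.1 * chart_inv b uv.2)%g in
        smooth ((chart_cod a `*` chart_cod b) `&` m @^-1` chart_dom c)
               (chart_map c \o m) &
      forall a b, A a -> A b ->
        let i := fun u : 'rV[R]_n => ((chart_inv a u)^-1)%g in
        smooth (chart_cod a `&` i @^-1` chart_dom b) (chart_map b \o i)]].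

Section CosetSpace.
Variables (G : topologicalGroupType) (Gamma : subgroup G).

Definition coset_rel : rel G :=
  fun x y => `[< subgroup_set Gamma (x^-1 * y)%g >].

Lemma coset_rel_equiv : equiv_class_of coset_rel.
Proof.
have [G1 GM GV] := subgroupP Gamma.
have sym x y : coset_rel x y -> coset_rel y x.
  by move=> /asboolP/GV; rewrite invgM invgK => ?; apply/asboolP.
split=> [x|x y|y x z /asboolP xy /asboolP yz].
- by apply/asboolP; rewrite mulVg.
- by apply/idP/idP => /sym.
- apply/asboolP; suff -> : (x^-1 * z = (x^-1 * y) * (y^-1 * z))%g by exact: GM.
  by rewrite -mulgA mulVKg.
Qed.

Canonical coset_equiv := EquivRelPack coset_rel_equiv.

(* The space [G / Gamma] of left cosets [g Gamma]. *)
Definition coset_space := quotient_topology {eq_quot coset_equiv}.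
HB.instance Definition _ := Topological.on coset_space.
HB.instance Definition _ := Quotient.on coset_space.

Lemma coset_piP (x y : G) :
  reflect (\pi_coset_space x = \pi_coset_space y) (coset_rel x y).
Proof. exact: (eqmodP coset_equiv). Qed.

Definition coset_translation (tau : G) (x : coset_space) : coset_space :=
  \pi_coset_space (tau * repr x)%g.

Lemma coset_translation_pi (tau g : G) :
  coset_translation tau (\pi_coset_space g) = \pi_coset_space (tau * g)%g.
Proof.
apply/coset_piP/asboolP; rewrite invgM -mulgA mulKg.
by apply/asboolP/coset_piP; rewrite reprK.
Qed.

End CosetSpace.

Record nilsystem (R : realType) (d : nat) := Nilsystem {
  nil_group : topologicalGroupType;
  nil_lie : lie_group R nil_group;
  nil_nilpotent : nilpotent_step nil_group d;
  nil_lattice : subgroup nil_group;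
  nil_discrete : isolated (subgroup_set nil_lattice) = subgroup_set nil_lattice;
  nil_cocompact : compact [set: coset_space nil_lattice];
  nil_elt : nil_group }.

Definition nil_space (R : realType) (d : nat) (N : nilsystem R d)
  : topologicalType := coset_space (nil_lattice N).

Definition nil_map (R : realType) (d : nat) (N : nilsystem R d)
  : nil_space N -> nil_space N := coset_translation (nil_elt N).

Definition system_of_order (R : realType) (d : nat) (X : topologicalType)
    (T : X -> X) : Prop :=
  [/\ tds R T, minimal T &
      exists (N : nat -> nilsystem R d)
             (p : forall i, nil_space (N i.+1) -> nil_space (N i)),
        is_inverse_limit T (fun i => @nil_map R d (N i)) p].

Section Torus.
Variable R : realType.

Definition modZ_rel : rel R := fun x y => (x - y) \is a Num.int.

Lemma modZ_rel_equiv : equiv_class_of modZ_rel.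
Proof.
split=> [x|x y|y x z xy yz]; rewrite /modZ_rel.
- by rewrite subrr rpred0.
- by rewrite -opprB rpredN.
- by rewrite -(subrK y x) -addrA rpredD.
Qed.

Canonical modZ_equiv := EquivRelPack modZ_rel_equiv.

Definition circle := quotient_topology {eq_quot modZ_equiv}.
HB.instance Definition _ := Topological.on circle.
HB.instance Definition _ := Quotient.on circle.

Lemma circle_piP (x y : R) :
  reflect (\pi_circle x = \pi_circle y) (modZ_rel x y).
Proof. exact: (eqmodP modZ_equiv). Qed.

(* The class [F_l]: lifts to the line of the circle maps of degree [l]. *)
Definition lifts (l : int) : set (R -> R) :=
  [set h : R -> R | continuous h /\ forall x : R, h (x + 1) - h x = l%:~R].

(* [(x, y) |-> (x + alpha, f x + y)]; see [skew_product_pi]. *)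
Definition skew_product (alpha : R) (f : R -> R) (z : circle * circle)
  : circle * circle :=
  (\pi_circle (repr z.1 + alpha), \pi_circle (f (repr z.1) + repr z.2)).

Lemma lifts_modZ (l : int) (f : R -> R) (x y : R) :
  lifts l f -> modZ_rel x y -> modZ_rel (f x) (f y).
Proof.
move=> [_ fl]; have fN (n : nat) u : modZ_rel (f (u + n%:R)) (f u).
  elim: n u => [|n IHn] u; first by rewrite addr0 /modZ_rel subrr rpred0.
  rewrite /modZ_rel -natr1 addrA -(subrK (f (u + n%:R)) (f _)) fl -addrA.
  by rewrite rpredD ?intr_int//; exact: IHn.
move=> /intrP[[n|n] xyn].
  by rewrite -(subrK y x) xyn addrC; exact: fN.
rewrite /modZ_rel -opprB rpredN; have -> : y = x + n.+1%:R; last exact: fN.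
by rewrite -[n.+1%:R]opprK -[- n.+1%:R]/((Negz n)%:~R) -xyn opprB addrC subrK.
Qed.

Lemma skew_product_pi (l : int) (alpha : R) (f : R -> R) (x y : R) :
  lifts l f ->
  skew_product alpha f (\pi_circle x, \pi_circle y) =
  (\pi_circle (x + alpha), \pi_circle (f x + y)).
Proof.
move=> fl; have reprZ u : modZ_rel (repr (\pi_circle u)) u.
  by apply/circle_piP; rewrite reprK.
congr pair; apply/circle_piP => /=; rewrite /modZ_rel.
  by rewrite opprD addrACA subrr addr0; exact: reprZ.
by rewrite opprD addrACA rpredD//; [exact: lifts_modZ fl _|]; exact: reprZ.
Qed.

End Torus.

(* Main.v *)
Require Import Defs.
From HB Require Import structures.
From mathcomp Require Import all_boot all_order all_algebra.
From mathcomp Require Import all_classical all_reals all_analysis.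
From mathcomp Require Import ring lra.

Set Implicit Arguments.
Unset Strict Implicit.
Unset Printing Implicit Defensive.

Import Order.TTheory GRing.Theory Num.Theory.
Import numFieldNormedType.Exports.

Local Open Scope classical_set_scope.
Local Open Scope ring_scope.

(** Write [T_f] for the skew product and [S_n f] for the Birkhoff sums
    [f x + f (x + alpha) + ... + f (x + (n - 1) alpha)], so that the [n]-th
    iterate of [T_f] is [(x, y) |-> (x + n alpha, y + S_n f x)].

    From a nilsystem to a coboundary. The torus is an inverse limit of nilsystems
    of step two, but it has no small subgroups: two points with the same image in
    a sufficiently fine factor differ by a translation all of whose multiples are
    small, so that some factor is already injective
    ([small_factor_injective]), and the torus itself is a nilsystem [G / Gamma].
    Let [tau] be the element of [G] acting as [T_f]. For small [h] the point
    [(h, 0)] is the image of [(0, 0)] under some [u] close to 1 in [G], and since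
    commutators are central, [tau^n u = z^n u tau^n] for a central [z]. As [z]
    commutes with the minimal map [T_f], it must act as a vertical rotation, by
    an angle [sigma] say, and comparing second coordinates gives
    [S_n f h - S_n f 0 = n sigma] modulo 1 up to a small error that does not
    depend on [n] ([nil_increments]). By the cocycle identity
    [S_n f (x + h) - S_n f x] then hardly depends on [x] modulo 1, hence, by
    continuity in [x], as a real number ([increment_near_cst]). For the periodic
    function [psi x = f x - l x] this says that the sums [S_n psi] are uniformly
    equicontinuous. Consequently they are bounded after subtraction of a constant
    from [psi], and their upper limit solves the cohomological equation
    ([equicontinuous_coboundary]).

    From a coboundary to a nilsystem. If [f] has the form stated, [T_f] is
    conjugate by [(x, y) |-> (x, y - phi x)] to
    [(x, y) |-> (x + alpha, y + l x + c)]. The transformations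
    [(x, y) |-> (x + a, y + k l x + b)], with [k] an integer and [a], [b] real,
    form a Lie group of nilpotency class two which acts transitively on the torus,
    the stabilizer of [(0, 0)] being discrete ([shear_lie_group],
    [shear_nilpotent]); this exhibits a nilsystem. Minimality ([affine_minimal])
    follows from a shearing argument: nearby points drift apart vertically at a
    speed proportional to [l], so a minimal closed invariant set is preserved by
    all vertical rotations. *)

(** * Distance to the nearest integer *)

Section DistanceToIntegers.
Variable R : realType.
Implicit Types x y b : R.

Definition distZ x : R := `|x - (Num.floor (x + 2^-1))%:~R|.

Lemma distZ_ge0 x : 0 <= distZ x. Proof. exact: normr_ge0. Qed.

Lemma distZ_witness x : exists k : int, distZ x = `|x - k%:~R|.
Proof. by eexists. Qed.

Lemma distZ_le_half x : distZ x <= 2^-1.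
Proof.
rewrite /distZ ler_norml.
by have := floor_le (x + 2^-1); have := floorD1_gt (x + 2^-1); rewrite intrD; lra.
Qed.

Lemma distZ_le_norm x (k : int) : distZ x <= `|x - k%:~R|.
Proof.
rewrite /distZ; set f := Num.floor _.
have [->//|kf] := eqVneq k f.
have : distZ x <= 2^-1 := distZ_le_half x.
rewrite /distZ -/f => /le_trans; apply.
have h1 := floor_le (x + 2^-1); have := floorD1_gt (x + 2^-1).
rewrite -/f intrD => h2; rewrite -/f in h1.
have [fk|] := ltP f k.
  have : f%:~R + 1 <= k%:~R :> R by rewrite -[1]/(1%:~R) -intrD ler_int lezD1.
  by rewrite ler_normr; lra.
rewrite le_eqVlt (negbTE kf)/= => fk.
have : k%:~R + 1 <= f%:~R :> R by rewrite -[1]/(1%:~R) -intrD ler_int lezD1.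
by rewrite ler_normr; lra.
Qed.

Lemma distZ_le x : distZ x <= `|x|.
Proof. by have := distZ_le_norm x 0; rewrite subr0. Qed.

Lemma distZD x y : distZ (x + y) <= distZ x + distZ y.
Proof.
have [k ->] := distZ_witness x; have [j ->] := distZ_witness y.
apply: le_trans (distZ_le_norm _ (k + j)) _.
by rewrite intrD opprD addrACA ler_normD.
Qed.

Lemma distZN x : distZ (- x) = distZ x.
Proof.
suff le z : distZ (- z) <= distZ z.
  by apply/eqP; rewrite eq_le le -{1}[x]opprK le.
have [k ->] := distZ_witness z.
apply: le_trans (distZ_le_norm _ (- k)) _.
by rewrite rmorphN -opprD normrN.
Qed.

Lemma distZB x y : distZ (x - y) <= distZ x + distZ y.
Proof. by rewrite -(distZN y) distZD. Qed.

Lemma distZ_int x : x \is a Num.int -> distZ x = 0.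
Proof.
move=> /intrP[k ->]; apply/eqP; rewrite eq_le distZ_ge0 andbT.
by apply: le_trans (distZ_le_norm _ k) _; rewrite subrr normr0.
Qed.

Lemma distZ_eq0 x : distZ x = 0 -> x \is a Num.int.
Proof.
have [k ->] := distZ_witness x => /eqP; rewrite normr_eq0 subr_eq0 => /eqP ->.
exact: intr_int.
Qed.

Lemma distZ_modZ x y : modZ_rel x y -> distZ x = distZ y.
Proof.
move=> xy; have := distZ_int xy => d0.
apply/eqP; rewrite eq_le -{1}(subrK y x) (le_trans (distZD _ _)) ?d0 ?add0r//=.
by rewrite -{1}(subrK x y) (le_trans (distZD _ _)) // -opprB distZN d0 add0r.
Qed.

(** This is what allows a small quantity known modulo 1 to be treated as a real
    number. *)
Lemma distZ_small x : `|x| <= 2^-1 -> distZ x = `|x|.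
Proof.
move=> xh; apply/eqP; rewrite eq_le distZ_le /=.
have [k ->] := distZ_witness x.
have [->|k0] := eqVneq k 0; first by rewrite subr0.
have : 1 <= `|k%:~R : R| by rewrite -intr_norm ler1z -gtz0_ge1 normr_gt0.
by move=> k1; have := lerB_normD (k%:~R : R) (- x); rewrite normrN distrC; lra.
Qed.

(** The circle has no small subgroups: if all multiples of a nonzero class stay
    close to 0, the first one leaving the ball of radius 1/5 lands in the ball of
    radius 2/5, where the distance to the integers is still the absolute value. *)
Lemma int_small_multiples b :
  (forall n : nat, distZ (n%:R * b) <= 5^-1) -> b \is a Num.int.
Proof.
move=> small; apply: distZ_eq0; apply/eqP; rewrite eq_le distZ_ge0 andbT.
rewrite leNgt; apply/negP => d0.
have [k dk] := distZ_witness b.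
pose c := b - k%:~R; pose d := distZ b.
have d5 : d <= 5^-1 by have := small 1%N; rewrite mul1r.
pose n := Num.truncn (5^-1 / d).
have nd : n%:R * d <= 5^-1.
  by rewrite -ler_pdivlMr// /n truncn_le // divr_ge0 // ?invr_ge0 // ltW.
have Snd : 5^-1 < n.+1%:R * d by rewrite -ltr_pdivrMr // truncnS_gt.
have : distZ (n.+1%:R * b) = distZ (n.+1%:R * c).
  apply: distZ_modZ; rewrite /modZ_rel -mulrBr /c subKr.
  by rewrite rpredM ?natr_int ?intr_int.
have cd : `|n.+1%:R * c| = n.+1%:R * d.
  by rewrite normrM ger0_norm // /c -dk.
rewrite [RHS]distZ_small cd => [h|].
  by have := small n.+1; rewrite h leNgt Snd.
by rewrite mulrSr mulrDl mul1r; lra.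
Qed.

End DistanceToIntegers.

(** * Density of irrational rotations *)

Section IrrationalRotation.
Variables (R : realType) (alpha : R).
Hypothesis alpha_irr : irrational alpha.

(** By the pigeonhole principle two of the first multiples of [alpha] lie in the
    same box of length [1/M] modulo 1; their difference is not an integer since [alpha] is irrational. *)
Lemma dirichlet_small_multiple (e : R) : 0 < e ->
  exists (n : nat) (k : int), 0 < `|n%:R * alpha - k%:~R| < e.
Proof.
move=> e0; pose M := (Num.truncn e^-1).+1.
have M0 : (0 : R) < M%:R by rewrite ltr0n.
have Me : (M%:R : R)^-1 < e by rewrite invf_plt ?posrE // truncnS_gt.
pose fr (i : nat) : R := i%:R * alpha - (Num.floor (i%:R * alpha))%:~R.
have fr0 i : 0 <= fr i by rewrite subr_ge0 floor_le.
have fr1 i : fr i < 1 by rewrite ltrBlDl -[1]/(1%:~R) -intrD floorD1_gt.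
have box i : (Num.truncn (M%:R * fr i) < M)%N.
  rewrite -(ltr_nat R); apply: (@le_lt_trans _ _ (M%:R * fr i)).
    by rewrite truncn_le mulr_ge0 // ltW.
  by rewrite gtr_pMr.
pose g (i : 'I_M.+1) : 'I_M := Ordinal (box i).
have /injectivePn[i [j ij gij]] : ~~ injectiveb g.
  by apply/negP => /injectiveP/leq_card; rewrite !card_ord ltnn.
wlog lt_ij : i j ij gij / (i < j)%N.
  move=> W; have := ij; rewrite neq_ltn => /orP[|ji]; first exact: W.
  by apply: (W j i) => //; rewrite eq_sym.
have {}gij : Num.truncn (M%:R * fr i) = Num.truncn (M%:R * fr j).
  exact: (congr1 val gij).
exists (j - i)%N, (Num.floor (j%:R * alpha) - Num.floor (i%:R * alpha)).
have -> : (j - i)%:R * alpha -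
   (Num.floor (j%:R * alpha) - Num.floor (i%:R * alpha))%:~R = fr j - fr i.
  by rewrite natrB 1?ltnW // intrB /fr; ring.
apply/andP; split.
  rewrite normr_gt0; apply/eqP => fij; apply: alpha_irr.
  have nz : (j - i)%:R != 0 :> R by rewrite pnatr_eq0 subn_eq0 -ltnNge.
  exists ((Num.floor (j%:R * alpha) - Num.floor (i%:R * alpha))%:~R
          / (j - i)%:R) => //.
  rewrite rmorph_div /= ?unitfE ?pnatr_eq0 ?subn_eq0 -?ltnNge //.
  rewrite ratr_int ratr_nat; apply/(canLR (mulfK nz)); apply/esym.
  by rewrite mulrC natrB 1?ltnW // intrB; move: fij; rewrite /fr; lra.
apply: lt_trans Me.
have bi := truncn_itv (mulr_ge0 (ltW M0) (fr0 i)).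
have bj := truncn_itv (mulr_ge0 (ltW M0) (fr0 j)).
rewrite gij in bi; set t := Num.truncn _ in bi bj.
have {bi bj} : `|M%:R * fr j - M%:R * fr i| < 1.
  by move: bi bj; rewrite mulrSr ltr_norml => /andP[] + + /andP[]; lra.
by rewrite -mulrBr normrM ger0_norm ?ltW // -ltr_pdivlMl // mulr1.
Qed.

(** Stepping along a small nonzero multiple of [alpha], in the direction of its
    sign, passes within one step of any point modulo 1. Only forward times are
    used. *)
Lemma rotation_dense (x e : R) : 0 < e ->
  exists (n : nat) (k : int), `|n%:R * alpha + k%:~R - x| < e.
Proof.
move=> e0; have [m [k]] := dirichlet_small_multiple e0.
set d := _ - _ => /andP[d0 de].
have dn0 : d != 0 by rewrite -normr_gt0.
(* The representative [x - p] of [x] is chosen with the same sign as [d], so that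
   the number of steps is a natural number. *)
have [p pd] : exists p : int, 0 <= (x - p%:~R) / d.
  have [dpos|dneg] := ltP 0 d.
    by exists (Num.floor x); apply: divr_ge0; [rewrite subr_ge0 floor_le|exact: ltW].
  exists (Num.floor x + 1); apply: mulr_le0; last by rewrite invr_le0.
  by rewrite subr_le0 ltW // floorD1_gt.
pose j := Num.truncn ((x - p%:~R) / d).
exists (j * m)%N, (p - k *+ j).
have -> : (j * m)%:R * alpha + (p - k *+ j)%:~R - x = j%:R * d - (x - p%:~R).
  by rewrite natrM intrB rmorphMn /= /d; ring.
have -> : j%:R * d - (x - p%:~R) = (j%:R - (x - p%:~R) / d) * d.
  by rewrite mulrBl divfK.
apply: le_lt_trans de; rewrite normrM ler_piMl //.
have := truncn_itv pd; rewrite -/j => /andP[].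
by rewrite mulrSr ler_norml; lra.
Qed.

End IrrationalRotation.

(** * Birkhoff sums over a rotation *)

Section BirkhoffSums.
Variables (R : realType) (alpha : R).
Implicit Types (g psi phi : R -> R) (x h : R).

Definition birkhoff g (n : nat) x : R := \sum_(i < n) g (x + i%:R * alpha).

Lemma birkhoff0 g x : birkhoff g 0 x = 0.
Proof. by rewrite /birkhoff big_ord0. Qed.

Lemma birkhoffS g n x : birkhoff g n.+1 x = birkhoff g n x + g (x + n%:R * alpha).
Proof. by rewrite /birkhoff big_ord_recr. Qed.

Lemma birkhoffD g m n x :
  birkhoff g (m + n) x = birkhoff g m x + birkhoff g n (x + m%:R * alpha).
Proof.
elim: n => [|n IHn]; first by rewrite addn0 birkhoff0 addr0.
by rewrite addnS !birkhoffS IHn addrA natrD mulrDl !addrA.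
Qed.

Lemma birkhoff_shift g n x :
  birkhoff g n (x + alpha) = birkhoff g n.+1 x - g x.
Proof.
rewrite -add1n birkhoffD mul1r.
by rewrite /birkhoff big_ord1 mul0r addr0 [g x + _]addrC addrK.
Qed.

Lemma birkhoff_sub_cst g c n x :
  birkhoff (fun t => g t - c) n x = birkhoff g n x - n%:R * c.
Proof. by rewrite /birkhoff sumrB sumr_const card_ord mulr_natl. Qed.

Lemma birkhoff_continuous g n : continuous g -> continuous (birkhoff g n).
Proof.
move=> gc x; elim: n => [|n IHn].
  rewrite (_ : birkhoff g 0 = cst 0); first exact: cvg_cst.
  by apply/funext => t; rewrite birkhoff0.
rewrite (_ : birkhoff g n.+1 = fun t => birkhoff g n t + g (t + n%:R * alpha)).
  apply: cvgD; first exact: IHn.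
  apply: continuous_comp; last exact: gc.
  by apply: cvgD; [exact: cvg_id|exact: cvg_cst].
by apply/funext => t; rewrite birkhoffS.
Qed.

Lemma birkhoff_periodic psi n x :
  (forall t, psi (t + 1) = psi t) -> birkhoff psi n (x + 1) = birkhoff psi n x.
Proof. by move=> per; apply: eq_bigr => i _; rewrite addrAC per. Qed.

End BirkhoffSums.

Section Periodic.
Variable R : realType.
Implicit Types (g : R -> R) (x : R).

Lemma periodic_nat g (n : nat) x :
  (forall t, g (t + 1) = g t) -> g (x + n%:R) = g x.
Proof.
by move=> per; elim: n => [|n IHn]; rewrite ?addr0 // -natr1 addrA per.
Qed.

Lemma periodic_int g (k : int) x :
  (forall t, g (t + 1) = g t) -> g (x + k%:~R) = g x.
Proof.
move=> per; case: k => n; first exact: periodic_nat.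
by rewrite -(periodic_nat n.+1 (_ + _) per) NegzE rmorphN /= subrK.
Qed.

Lemma periodic_bounded g : continuous g -> (forall t, g (t + 1) = g t) ->
  exists C, forall x, `|g x| <= C.
Proof.
move=> gc per.
have gw : {within `[0, 1], continuous (fun t : R => `|g t|)}.
  apply: continuous_subspaceT => x.
  by apply: (@continuous_comp _ _ _ g (fun y : R => `|y|));
    [exact: gc|exact: norm_continuous].
have [c _ cmax] := EVT_max (@ler01 R) gw.
exists `|g c| => x.
rewrite -(periodic_int (- Num.floor x) x per).
apply: cmax; rewrite in_itv /= rmorphN /= subr_ge0 floor_le /=.
by have := floorD1_gt x; rewrite intrD; lra.
Qed.

End Periodic.

(** Comparing [a (m * n)] both with [n * a m] and with [m * a n] shows that every
    [(a m - C) / m] is below every [(a n + C) / n]; any [c] in between works. *)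
Lemma quasimorphism_linear (R : realType) (a : nat -> R) (C : R) :
  (forall m n, `|a (m + n)%N - a m - a n| <= C) ->
  exists c, forall n, `|a n - n%:R * c| <= C.
Proof.
move=> qm.
have C0 : 0 <= C by apply: le_trans (qm 0 0)%N; exact: normr_ge0.
have a0 : `|a 0%N| <= C.
  by have := qm 0%N 0%N; rewrite addn0 subrr sub0r normrN.
have mul m n : `|a (n.+1 * m)%N - n.+1%:R * a m| <= n%:R * C.
  elim: n => [|n IHn]; first by rewrite mul1n mul1r subrr normr0 mul0r.
  rewrite [(n.+2 * m)%N]mulSn addnC.
  have -> : a (n.+1 * m + m)%N - n.+2%:R * a m =
      (a (n.+1 * m + m)%N - a (n.+1 * m)%N - a m)
      + (a (n.+1 * m)%N - n.+1%:R * a m) by rewrite -[n.+2%:R]natr1; ring.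
  rewrite -[n.+1%:R as X in _ <= X * _]natr1 mulrDl mul1r [_ * C + C]addrC.
  by apply: le_trans (ler_normD _ _) (lerD _ _).
have cmp m n : (a m.+1 - C) / m.+1%:R <= (a n.+1 + C) / n.+1%:R.
  rewrite ler_pdivrMr ?ltr0n // mulrAC ler_pdivlMr ?ltr0n //.
  have := mul m.+1 n; have := mul n.+1 m.
  rewrite [(m.+1 * n.+1)%N]mulnC !ler_norml => /andP[h1 h2] /andP[h3 h4].
  rewrite mulrBl mulrDl [a m.+1 * _]mulrC [a n.+1 * _]mulrC.
  rewrite ![C * _]mulrC -![_.+1%:R as X in X * C]natr1 !mulrDl !mul1r; lra.
pose E := [set (a m.+1 - C) / m.+1%:R | m in [set: nat]].
have Ene : E !=set0 by exists ((a 1%N - C) / 1); exists 0%N.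
exists (sup E) => -[|n]; first by rewrite mul0r subr0.
have lo : (a n.+1 - C) / n.+1%:R <= sup E.
  apply: ub_le_sup; last by exists n.
  by exists ((a 1%N + C) / 1) => _ [m _ <-]; exact: (cmp m 0%N).
have hi : sup E <= (a n.+1 + C) / n.+1%:R.
  by apply: ge_sup => // _ [m _ <-]; exact: cmp.
move: lo hi; rewrite ler_pdivrMr ?ltr0n // ler_pdivlMr ?ltr0n // ler_norml.
by rewrite [sup E * _]mulrC; lra.
Qed.

Section Coboundary.
Variables (R : realType) (alpha : R) (psi : R -> R).
Hypothesis psi_per : forall t, psi (t + 1) = psi t.
Local Notation S := (birkhoff alpha psi).
Hypothesis S_equicontinuous : forall e, 0 < e -> exists2 d, 0 < d &
  forall (n : nat) (x h : R), `|h| < d -> `|S n (x + h) - S n x| <= e.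

Lemma birkhoff_oscillation : exists C, forall n x y, `|S n y - S n x| <= C.
Proof.
have [d d0 Sd] := S_equicontinuous (@ltr01 R).
pose N := (Num.truncn d^-1).+1.
have N0 : (0 : R) < N%:R by rewrite ltr0n.
have Nd : (N%:R : R)^-1 < d by rewrite invf_plt ?posrE // truncnS_gt.
(* [N] steps shorter than [d] lead across a whole period. *)
have chain n x h : `|h| < d -> forall k : nat, `|S n (x + k%:R * h) - S n x| <= k%:R.
  move=> hd; elim=> [|k IHk]; first by rewrite mul0r addr0 subrr normr0.
  have -> : x + k.+1%:R * h = (x + k%:R * h) + h by rewrite -natr1; ring.
  rewrite -natr1 -(subrKA (S n (x + k%:R * h))).
  by rewrite [_ + 1]addrC (le_trans (ler_normD _ _)) // lerD // Sd.
exists N%:R => n x y.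
pose t := y - x - (Num.floor (y - x))%:~R.
have -> : S n y = S n (x + t).
  rewrite -(periodic_int (- Num.floor (y - x)) y); last first.
    by move=> u; exact: birkhoff_periodic.
  by congr (S n _); rewrite rmorphN /= /t; ring.
have /andP[t_ge0 t_le1] : 0 <= t <= 1.
  have := floor_le (y - x); have := floorD1_gt (y - x).
  by rewrite /t intrD; lra.
have -> : t = N%:R * (t / N%:R) by rewrite mulrC divfK // gt_eqF.
apply: chain; rewrite ger0_norm ?divr_ge0 //.
by apply: le_lt_trans Nd; rewrite ler_pdivrMr // mulVf // gt_eqF.
Qed.

Lemma birkhoff_bounded : exists c C, forall n x,
  `|birkhoff alpha (fun t => psi t - c) n x| <= C.
Proof.
have [C osc] := birkhoff_oscillation.
have [c lin] : exists c, forall n, `|S n 0 - n%:R * c| <= C.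
  apply: quasimorphism_linear => m n.
  by rewrite birkhoffD add0r [_ + S n _]addrC addrK osc.
exists c, (C + C) => n x; rewrite birkhoff_sub_cst -(subrKA (S n 0)).
by rewrite (le_trans (ler_normD _ _)) // lerD.
Qed.

(** Once the Birkhoff sums of [psi - c] are bounded, the supremum [v] of the
    numbers that they exceed infinitely often, which is their upper limit,
    satisfies [v (x + alpha) = v x - (psi x - c)]: dropping the first term of the
    sums does not change an upper limit. Equicontinuity of the sums passes to
    [v]. *)
Lemma equicontinuous_coboundary : exists (phi : R -> R) (c : R),
  lifts 0 phi /\ forall x, psi x = phi (x + alpha) - phi x + c.
Proof.
have [c [C bnd]] := birkhoff_bounded.
pose s := birkhoff alpha (fun t => psi t - c).
have s_shift n x : s n (x + alpha) = s n.+1 x - (psi x - c).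
  exact: birkhoff_shift.
pose often x : set R := [set a | forall k : nat, exists2 n, (k <= n)%N & a <= s n x].
have often_lo x : often x (- C).
  by move=> k; exists k => //; have := bnd k x; rewrite ler_norml => /andP[].
have often_ub x : ubound (often x) C.
  move=> a /(_ 0%N)[n _ /le_trans]; apply.
  by have := bnd n x; rewrite ler_norml => /andP[].
have often_hs x : has_sup (often x).
  by split; [exists (- C)|exists C].
pose v x := sup (often x).
have v_le x y e : (forall n, s n x <= s n y + e) -> v x <= v y + e.
  move=> le_s; apply: ge_sup; first by exists (- C).
  move=> a ax; rewrite -lerBlDr; apply: ub_le_sup; first by exists C.
  by move=> k; have [n kn asn] := ax k; exists n => //; have := le_s n; lra.
have v_shift x : v (x + alpha) = v x - (psi x - c).
  apply/eqP; rewrite eq_le; apply/andP; split.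
    apply: ge_sup; first by exists (- C).
    move=> a ax; rewrite lerBrDr; apply: ub_le_sup; first by exists C.
    move=> k; have [n kn asn] := ax k; exists n.+1; first exact: leqW.
    by move: asn; rewrite s_shift; lra.
  rewrite lerBlDr; apply: ge_sup; first by exists (- C).
  move=> a ax; rewrite -lerBlDr; apply: ub_le_sup; first by exists C.
  move=> k; have [[//|n] kn asn] := ax k.+1; exists n => //.
  by rewrite s_shift; lra.
exists (fun x => - v x), c; split; last first.
  by move=> x; rewrite v_shift; ring.
split; last first.
  have s_per n x : s n (x + 1) = s n x.
    by apply: birkhoff_periodic => t; rewrite psi_per.
  move=> x; suff -> : v (x + 1) = v x by rewrite subrr.
  have le1 : v (x + 1) <= v x + 0 by apply: v_le => n; rewrite s_per addr0.
  have le2 : v x <= v (x + 1) + 0 by apply: v_le => n; rewrite s_per addr0.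
  by apply/eqP; rewrite eq_le; move: le1 le2; rewrite !addr0 => -> ->.
move=> x; apply/cvgrPdist_le => /= e e0.
have [d d0 Sd] := S_equicontinuous e0.
exists d => //= y; rewrite /ball /= => xyd.
have s_close n z w : `|z - w| < d -> s n z <= s n w + e.
  move=> zw; rewrite /s !birkhoff_sub_cst.
  by have := Sd n w (z - w) zw; rewrite [w + _]addrC subrK ler_norml; lra.
have := v_le x y e (fun n => s_close n x y xyd).
have := v_le y x e (fun n => s_close n y x _).
by rewrite distrC xyd => /(_ isT); rewrite ler_norml; lra.
Qed.

End Coboundary.

Section IncrementsToCoboundary.
Variables (R : realType) (l : int) (alpha : R) (f : R -> R).
Hypothesis f_lift : lifts l f.
Local Notation S := (birkhoff alpha).

Definition increment (h : R) (n : nat) (x : R) : R := S f n (x + h) - S f n x.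

Lemma lift_continuous : continuous f. Proof. by case: f_lift. Qed.

Lemma increment_continuous h n : continuous (increment h n).
Proof.
move=> x; apply: cvgB; last exact/birkhoff_continuous/lift_continuous.
apply: (@continuous_comp _ _ _ (fun t => t + h)).
  by apply: cvgD; [exact: cvg_id|exact: cvg_cst].
exact/birkhoff_continuous/lift_continuous.
Qed.

Lemma increment_periodic h n x : increment h n (x + 1) = increment h n x.
Proof.
rewrite /increment /birkhoff -!sumrB; apply: eq_bigr => i _.
have f1 t : f (t + 1) = f t + l%:~R by have := f_lift.2 t; lra.
have -> : x + 1 + h + i%:R * alpha = x + h + i%:R * alpha + 1 by ring.
by rewrite [x + 1 + _]addrAC !f1; ring.
Qed.

Lemma incrementD h m n x :
  increment h (m + n) x = increment h m x + increment h n (x + m%:R * alpha).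
Proof. by rewrite /increment !birkhoffD [x + _ + h]addrAC; ring. Qed.

Definition periodic_part (t : R) : R := f t - l%:~R * t.

Lemma periodic_part_continuous : continuous periodic_part.
Proof.
move=> x; apply: cvgB; first exact: lift_continuous.
by apply: cvgM; [exact: cvg_cst|exact: cvg_id].
Qed.

Lemma periodic_part_periodic t : periodic_part (t + 1) = periodic_part t.
Proof. by have := f_lift.2 t; rewrite /periodic_part; lra. Qed.

Lemma increment_periodic_part h n x :
  increment h n x = S periodic_part n (x + h) - S periodic_part n x
                    + n%:R * (l%:~R * h).
Proof.
rewrite /increment /birkhoff -!sumrB.
have -> : n%:R * (l%:~R * h) = \sum_(i < n) (l%:~R * h).
  by rewrite sumr_const card_ord mulr_natl.
by rewrite -big_split; apply: eq_bigr => i _ /=; rewrite /periodic_part; ring.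
Qed.

(** By the intermediate value theorem [`|w|] could not exceed 1/2 without taking
    the value 1/2, at which [w] is far from the integers. *)
Lemma near_integers_near_0 (w : R -> R) (e : R) : continuous w -> w 0 = 0 ->
  e < 2^-1 -> (forall x, distZ (w x) <= e) -> forall x, `|w x| <= e.
Proof.
move=> wc w0 e2 we x; have [wx|wx] := leP `|w x| 2^-1.
  by rewrite -distZ_small.
pose g t := `|w (t * x)|.
have gc : {within `[0, 1], continuous g}.
  apply: continuous_subspaceT => t.
  apply: cvg_norm.
  have xc : {for t, continuous (fun t : R => t * x)}.
    by apply: cvgM; [exact: cvg_id|exact: cvg_cst].
  exact: (continuous_comp xc (wc _)).
have [|c _ gc2] := @IVT _ g _ _ 2^-1 (@ler01 R) gc.
  rewrite /g mul0r mul1r w0 normr0; apply/andP; split.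
    by rewrite ge_min invr_ge0 ler0n.
  by rewrite le_max (ltW wx) orbT.
by have := we (c * x); rewrite distZ_small -/(g c) gc2 // leNgt e2.
Qed.

Hypothesis alpha_irr : irrational alpha.

(** If the increments along the orbit of 0 are additive up to a small error
    modulo 1, then by the cocycle identity the increments based at [m * alpha]
    agree with those based at 0, and density and continuity give the same at
    every base point. As the increments are continuous functions of the base
    point, the error is small in the reals and not only modulo 1. *)
Lemma increment_near_cst (h sigma e : R) : 0 < e -> 4 * e < 2^-1 ->
  (forall n, distZ (increment h n 0 - n%:R * sigma) <= e) ->
  forall n x, `|increment h n x - increment h n 0| <= 4 * e.
Proof.
move=> e0 e4 lin n.
pose w x := increment h n x - increment h n 0.
have w_cont : continuous w.
  by move=> x; apply: cvgB; [exact: increment_continuous|exact: cvg_cst].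
apply: (@near_integers_near_0 w) => //; first by rewrite /w subrr.
have orb m : distZ (w (m%:R * alpha)) <= 3 * e.
  have -> : w (m%:R * alpha) = (increment h (m + n) 0 - (m + n)%:R * sigma)
      - (increment h m 0 - m%:R * sigma) - (increment h n 0 - n%:R * sigma).
    by rewrite /w incrementD add0r natrD; ring.
  apply: le_trans (distZB _ _) _.
  have := distZB (increment h (m + n) 0 - (m + n)%:R * sigma)
                 (increment h m 0 - m%:R * sigma).
  by have := lin m; have := lin n; have := lin (m + n)%N; lra.
move=> x.
have /cvgrPdist_lt /(_ e e0) [d /= d0 wd] := w_cont x.
have [m [k mk]] := rotation_dense alpha_irr x d0.
have : `|w x - w (m%:R * alpha + k%:~R)| < e by apply: wd; rewrite /ball /= distrC.
have -> : w (m%:R * alpha + k%:~R) = w (m%:R * alpha).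
  by apply: periodic_int => t; rewrite /w increment_periodic.
move=> wxe; have := orb m.
have := distZ_le (w x - w (m%:R * alpha)).
have := distZD (w x - w (m%:R * alpha)) (w (m%:R * alpha)).
by rewrite subrK; lra.
Qed.

(** Telescoping along the points [0, h, 2 * h] and so on bounds the multiples of
    the increment of a Birkhoff sum of the periodic part, so that increment is
    as small as its variation in the base point. *)
Lemma linear_increments_coboundary :
  (forall e, 0 < e -> exists2 d, 0 < d & forall h, `|h| < d ->
     exists sigma, forall n, distZ (increment h n 0 - n%:R * sigma) <= e) ->
  exists (phi : R -> R) (c : R), lifts 0 phi /\
    forall x, f x = l%:~R * x + phi (x + alpha) - phi x + c.
Proof.
move=> lin.
have [e e0|phi [c [phi0 E]]] :=
  @equicontinuous_coboundary _ alpha _ periodic_part_periodic; last first.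
  exists phi, c; split=> // x; have := E x; rewrite /periodic_part; lra.
(* The bound [8 * e1] obtained below is at most [e], and [4 * e1] is below 1/2 as
   required for passing from the circle to the line. *)
pose e1 := Num.min (e / 8) (10^-1).
have e10 : 0 < e1 by rewrite lt_min; apply/andP; split; lra.
have le8 : e1 <= e / 8 by rewrite ge_min lexx.
have le10 : e1 <= 10^-1 by rewrite ge_min lexx orbT.
have e1e : 8 * e1 <= e by lra.
have e1h : 4 * e1 < 2^-1 by lra.
have [d d0 small] := lin e1 e10; exists d => // n x h hd.
have [sigma sig] := small h hd.
pose E x := S periodic_part n (x + h) - S periodic_part n x.
have E_cst y : `|E y - E 0| <= 4 * e1.
  have := increment_near_cst e10 e1h sig n y.
  by rewrite !increment_periodic_part opprD addrACA subrr addr0.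
have [C bnd] := periodic_bounded
  (birkhoff_continuous (n := n) (alpha := alpha) periodic_part_continuous)
  (fun t => birkhoff_periodic alpha n t periodic_part_periodic).
(* [N * E 0] differs by at most [N * (4 * e1)] from a quantity that is bounded
   independently of [N]. *)
have tele (N : nat) :
    `|S periodic_part n (N%:R * h) - S periodic_part n 0 - N%:R * E 0| <= N%:R * (4 * e1).
  elim: N => [|N IHN]; first by rewrite !mul0r subrr subr0 normr0.
  have -> : S periodic_part n (N.+1%:R * h) - S periodic_part n 0 - N.+1%:R * E 0 =
     (S periodic_part n (N%:R * h) - S periodic_part n 0 - N%:R * E 0)
     + (E (N%:R * h) - E 0).
    have -> : N.+1%:R * h = N%:R * h + h by rewrite -natr1; ring.
    by rewrite -[N.+1%:R]natr1 [E (N%:R * h)]/E; ring.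
  rewrite -[N.+1%:R]natr1 mulrDl mul1r.
  by rewrite (le_trans (ler_normD _ _)) // lerD.
have E0 : `|E 0| <= 4 * e1.
  rewrite leNgt; apply/negP => big.
  pose g := `|E 0| - 4 * e1; have g0 : 0 < g by rewrite subr_gt0.
  pose N := (Num.truncn ((C + C) / g)).+1.
  have : C + C < N%:R * g by rewrite -ltr_pdivrMr // truncnS_gt.
  have : N%:R * `|E 0| <= C + C + N%:R * (4 * e1).
    rewrite -[N%:R in X in X <= _]ger0_norm // -normrM.
    have -> : N%:R * E 0 = (S periodic_part n (N%:R * h) - S periodic_part n 0)
      - (S periodic_part n (N%:R * h) - S periodic_part n 0 - N%:R * E 0) by ring.
    rewrite (le_trans (ler_normB _ _)) // lerD // (le_trans (ler_normB _ _)) //.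
    by rewrite lerD.
  by rewrite /g mulrBr; lra.
rewrite -/(E x); apply: le_trans e1e.
have := ler_normD (E x - E 0) (E 0); rewrite subrK.
by have := E_cst x; lra.
Qed.

End IncrementsToCoboundary.

(** * The circle and the torus *)

Lemma pair_continuous_at (X Y Z : topologicalType) (f : X -> Y) (g : X -> Z)
    (x : X) : {for x, continuous f} -> {for x, continuous g} ->
  {for x, continuous (fun u => (f u, g u))}.
Proof.
move=> fx gx A [[B C] /= [/fx nB /gx nC] BCA].
have nBC : nbhs x (f @^-1` B `&` g @^-1` C) by exact: filterI.
by apply: filterS nBC => u [Bu Cu]; exact: (BCA (_, _)).
Qed.

Lemma fst_continuous (X Y : topologicalType) : continuous (@fst X Y).
Proof. by move=> x; exact: cvg_fst. Qed.

Lemma snd_continuous (X Y : topologicalType) : continuous (@snd X Y).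
Proof. by move=> x; exact: cvg_snd. Qed.

Section Circle.
Variable R : realType.
Local Notation circle := (circle R).
Local Open Scope quotient_scope.
Implicit Types (x y b : R) (z : circle).

Definition cpi x : circle := \pi_circle x.

Lemma cpi_surj z : exists x, z = cpi x.
Proof. by exists (repr z); rewrite /cpi reprK. Qed.

Lemma cpiP x y : cpi x = cpi y <-> modZ_rel x y.
Proof. by split => [/circle_piP|xy] //; apply/circle_piP. Qed.

Lemma cpi_addint x (k : int) : cpi (x + k%:~R) = cpi x.
Proof. by apply/cpiP; rewrite /modZ_rel addrAC subrr add0r intr_int. Qed.

Lemma cpi_cancel x y b : cpi (x + b) = cpi (y + b) -> cpi x = cpi y.
Proof.
move=> /cpiP h; apply/cpiP; move: h; rewrite /modZ_rel.
by rewrite opprD addrACA subrr addr0.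
Qed.

Lemma cpi_continuous : continuous cpi.
Proof. exact: pi_continuous. Qed.

(** The projection of the line on the circle is open, so neighborhoods in the
    circle are the images of those in the line. *)
Lemma nbhs_cpi x (A : set circle) :
  nbhs (cpi x) A <-> exists2 e : R, 0 < e & forall y, `|y - x| < e -> A (cpi y).
Proof.
split=> [|[e e0 eA]].
  move=> /cpi_continuous/nbhs_ballP[e /= e0 eA]; exists e => // y yx.
  by apply: eA; rewrite /ball /= distrC.
pose U := [set z : circle | exists2 y, `|y - x| < e & z = cpi y].
have oU : open U.
  rewrite /open /= /quotient_open.
  have -> : \pi_circle @^-1` U =
      \bigcup_(k in [set: int]) [set y | `|y + k%:~R - x| < e].
    apply/seteqP; split => y /=.
      move=> [t + /cpiP yt]; have /intrP[k kE] := yt.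
      have -> : t = y + (- k)%:~R by rewrite intrN -kE subKr.
      by exists (- k).
    by move=> [k _ /= ykx]; exists (y + k%:~R) => //; rewrite -/(cpi y) cpi_addint.
  apply: bigcup_open => k _.
  apply: (@open_comp _ _ (fun y : R => y + k%:~R) [set t | `|t - x| < e]).
    by move=> y _; apply: cvgD; [exact: cvg_id|exact: cvg_cst].
  have := ball_open (x : R^o) e; rewrite /ball /=; congr open.
  by apply/seteqP; split => t /=; rewrite distrC.
apply: (@filterS _ _ _ U); first by move=> _ [y yx ->]; exact: eA.
by apply: open_nbhs_nbhs; split => //; exists x => //; rewrite subrr normr0.
Qed.

Lemma circle_hausdorff : hausdorff_space circle.
Proof.
move=> z w zw; have [x zE] := cpi_surj z; have [y wE] := cpi_surj w.
rewrite zE wE in zw *; apply/cpiP.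
apply: distZ_eq0; apply/eqP; rewrite eq_le distZ_ge0 andbT leNgt; apply/negP => d0.
pose e := distZ (x - y) / 2; have e0 : 0 < e by rewrite divr_gt0.
pose B u := [set t | exists2 v, `|v - u| < e & t = cpi v].
have BN u : nbhs (cpi u) (B u) by apply/nbhs_cpi; exists e => // v vu; exists v.
have [_ [[u ux ->] [v vy /cpiP uv]]] := zw _ _ (BN x) (BN y).
suff : distZ (x - y) < e + e by rewrite /e; lra.
rewrite (@distZ_modZ _ _ ((x - u) + (v - y))); last first.
  rewrite /modZ_rel.
  by have -> : x - y - (x - u + (v - y)) = u - v by ring.
apply: le_lt_trans (distZ_le _) _; apply: le_lt_trans (ler_normD _ _) _.
by rewrite ltrD // distrC.
Qed.

Lemma circle_compact : compact [set: circle].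
Proof.
have -> : [set: circle] = cpi @` `[0, 1].
  apply/seteqP; split => // z _; have [x ->] := cpi_surj z.
  exists (x + (- Num.floor x)%:~R); last by rewrite cpi_addint.
  have := floor_le x; have := floorD1_gt x.
  by rewrite /= in_itv /= intrD rmorphN /=; lra.
apply: continuous_compact; last exact: segment_compact.
by apply: continuous_subspaceT; exact: cpi_continuous.
Qed.

Lemma circle_continuous (Y : topologicalType) (g : circle -> Y) :
  continuous (g \o cpi) -> continuous g.
Proof. by move=> gc; apply/quotient_continuous. Qed.

Definition rot b z : circle := cpi (repr z + b).

Lemma rot_cpi b x : rot b (cpi x) = cpi (x + b).
Proof.
apply/cpiP; rewrite /modZ_rel opprD addrACA subrr addr0.
by apply/cpiP; rewrite /cpi reprK.
Qed.

Lemma rot_continuous b : continuous (rot b).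
Proof.
apply: circle_continuous; rewrite (_ : _ \o _ = cpi \o (fun x => x + b)).
  move=> x; apply: continuous_comp; last exact: cpi_continuous.
  by apply: cvgD; [exact: cvg_id|exact: cvg_cst].
by apply/funext => x; rewrite /= rot_cpi.
Qed.

Lemma rotD a b z : rot a (rot b z) = rot (b + a) z.
Proof. by have [x ->] := cpi_surj z; rewrite !rot_cpi addrA. Qed.

Lemma rot0 z : rot 0 z = z.
Proof. by have [x ->] := cpi_surj z; rewrite rot_cpi addr0. Qed.

Lemma rotC a b z : rot a (rot b z) = rot b (rot a z).
Proof. by rewrite !rotD addrC. Qed.

Lemma rot_trans z w : exists b, w = rot b z.
Proof.
have [x ->] := cpi_surj z; have [y ->] := cpi_surj w.
by exists (y - x); rewrite rot_cpi addrC subrK.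
Qed.

Lemma rot_fix b z : rot b z = z <-> b \is a Num.int.
Proof.
have [x ->] := cpi_surj z; rewrite rot_cpi cpiP /modZ_rel.
by rewrite addrAC subrr add0r.
Qed.

End Circle.
Arguments cpi {R}.

Section Torus.
Variable R : realType.
Local Notation torus := (circle R * circle R)%type.
Implicit Types (s : torus) (x y a b t : R).

Definition tpi x y : torus := (cpi x, cpi y).

Lemma tpi_surj s : exists x y, s = tpi x y.
Proof.
case: s => z w; have [x ->] := cpi_surj z; have [y ->] := cpi_surj w.
by exists x, y.
Qed.

Lemma nbhs_tpi x y (A : set torus) : nbhs (tpi x y) A <->
  exists2 e : R, 0 < e &
    forall x' y', `|x' - x| < e -> `|y' - y| < e -> A (tpi x' y').
Proof.
split=> [[[/= B C] [/nbhs_cpi[b b0 bB] /nbhs_cpi[c c0 cC]] BCA]|[e e0 eA]].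
  exists (Num.min b c); first by rewrite lt_min b0.
  by move=> x' y'; rewrite !lt_min => /andP[h1 h2] /andP[h3 h4];
    apply: BCA; split; [exact: bB|exact: cC].
exists ([set z | exists2 x', `|x' - x| < e & z = cpi x'],
        [set z | exists2 x', `|x' - y| < e & z = cpi x']) => /=.
  by split; apply/nbhs_cpi; exists e => // v ?; exists v.
by move=> [_ _] [/= [x' xx' ->] [y' yy' ->]]; exact: eA.
Qed.

Lemma torus_hausdorff : hausdorff_space torus.
Proof.
move=> [z1 z2] [w1 w2] zw; congr pair; apply: circle_hausdorff => A B nA nB.
  have [||[a b] [[aA _] [aB _]]] := zw (A `*` setT) (B `*` setT).
  - by exists (A, setT) => //=; split => //; exact: filterT.
  - by exists (B, setT) => //=; split => //; exact: filterT.
  by exists a.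
have [||[a b] [[_ bA] [_ bB]]] := zw (setT `*` A) (setT `*` B).
- by exists (setT, A) => //=; split => //; exact: filterT.
- by exists (setT, B) => //=; split => //; exact: filterT.
by exists b.
Qed.

Lemma torus_compact : compact [set: torus].
Proof. by rewrite -setXTT; apply: compact_setX; exact: circle_compact. Qed.

Lemma torus_continuous (Y : topologicalType) (g : torus -> Y) :
  continuous (fun v : R * R => g (tpi v.1 v.2)) -> continuous g.
Proof.
move=> gc s A; have [x [y ->]] := tpi_surj s => /(gc (x, y)).
move=> /nbhs_ballP[e /= e0 eA]; apply/nbhs_tpi; exists e => // x' y' xx' yy'.
by apply: (eA (x', y')); split; rewrite /ball /= distrC.
Qed.

Lemma tpi_continuous : continuous (fun v : R * R => tpi v.1 v.2).
Proof.
move=> v; apply: (@pair_continuous_at _ _ _ (cpi \o fst) (cpi \o snd)).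
  by apply: continuous_comp; [exact: fst_continuous|exact: cpi_continuous].
by apply: continuous_comp; [exact: snd_continuous|exact: cpi_continuous].
Qed.

Definition hrot b s : torus := (rot b s.1, s.2).
Definition vrot t s : torus := (s.1, rot t s.2).

Lemma hrot_tpi b x y : hrot b (tpi x y) = tpi (x + b) y.
Proof. by rewrite /hrot /= rot_cpi. Qed.

Lemma vrot_tpi b x y : vrot b (tpi x y) = tpi x (y + b).
Proof. by rewrite /vrot /= rot_cpi. Qed.

Lemma vrot_continuous t : continuous (vrot t).
Proof.
move=> s; apply: (@pair_continuous_at _ _ _ fst (fun s => rot t s.2)).
  exact: fst_continuous.
by apply: continuous_comp; [exact: snd_continuous|exact: rot_continuous].
Qed.

End Torus.

(** * Skew products and their minimality *)

Section MinimalSets.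
Variables (X : topologicalType) (T : X -> X).

Definition forward_invariant (A : set X) := forall z, A z -> A (T z).

Lemma forward_invariant_iter A n z : forward_invariant A -> A z -> A (iter n T z).
Proof. by move=> AT Az; elim: n => //= n; exact: AT. Qed.

(** Zorn's lemma, applied to complements so that unions of chains are the upper
    bounds; compactness keeps the intersection of a chain nonempty. *)
Lemma minimal_forward_invariant (C : set X) : compact [set: X] ->
  closed C -> forward_invariant C -> C !=set0 ->
  exists A, [/\ A `<=` C, closed A, forward_invariant A, A !=set0 &
    forall B, B `<=` A -> closed B -> forward_invariant B -> B !=set0 -> A `<=` B].
Proof.
move=> cptX clC invC C0.
pose P (U : set X) := [/\ closed (~` U), forward_invariant (~` U) &
                          ~` U `&` C !=set0].
have [F FP totF|U [[clU invU [z [Uz Cz]]] maxU]] := @Zorn_bigcup X P.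
  split.
  - rewrite setC_bigcup; apply: closed_bigI => U /FP[].
    by move=> ? _ _; exact.
  - move=> z; rewrite setC_bigcup => Uz U FU.
    by have [_ inv _] := FP U FU; apply: inv; exact: Uz.
  have [F0|/set0P[U0 FU0]] := eqVneq F set0.
    by rewrite F0 bigcup_set0 setC0 setTI.
  pose G := [set S | exists2 U, F U & ~` U `&` C `<=` S].
  have GF : ProperFilter G.
    apply: Build_ProperFilter_ex.
      move=> S [U FU US]; have [_ _ [z zU]] := FP U FU.
      by exists z; exact: US.
    split; first by exists U0.
      move=> S1 S2 [U1 F1 s1] [U2 F2 s2].
      have [U12|U21] := totF U1 U2 F1 F2.
        exists U2 => // z [zU Cz]; split; last exact: s2.
        by apply: s1; split => // /U12.
      exists U1 => // z [zU Cz]; split; first exact: s1.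
      by apply: s2; split => // /U21.
    by move=> S1 S2 S12 [U FU US]; exists U => // z /US/S12.
  have [|z [_ clz]] := cptX G GF; first by exists U0.
  have inU U : F U -> (~` U) z /\ C z.
    move=> FU; have [clU _ _] := FP U FU.
    have : closed (~` U `&` C) by exact: closedI.
    apply => B nB.
    have [w [wU wB]] : (~` U `&` C) `&` B !=set0 by apply: clz => //; exists U.
    by exists w.
  exists z; split; last by have [] := inU U0 FU0.
  by rewrite setC_bigcup => U /inU[].
exists (~` U `&` C); split.
- by move=> ? [].
- exact: closedI.
- by move=> w [Uw Cw]; split; [exact: invU|exact: invC].
- by exists z.
move=> B BA clB invB [b Bb] w [Uw Cw].
have PB : P (~` B).
  by rewrite /P setCK; split => //; exists b; split => //; have [] := BA b Bb.
apply: contrapT => nBw; apply: (maxU (~` B)) => //.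
split; first by move=> v Uv Bv; have [] := BA v Bv.
by move=> /(_ w nBw).
Qed.

Lemma minimal_closed_invariant (A : set X) (x : X) : minimal T ->
  closed A -> (forall z, A (T z) <-> A z) -> A x -> forall z, A z.
Proof.
move=> Tmin clA AT Ax z; apply: contrapT => nAz.
have [||w [nAw]] := Tmin x (~` A); [by exists z|exact: closed_openC|].
have AT_iter n v : A (iter n T v) <-> A v.
  by elim: n => //= n IHn; rewrite AT.
case=> n [wE|xE]; apply: nAw; first by rewrite wE; apply/AT_iter.
by apply/(AT_iter n); rewrite xE.
Qed.

Lemma minimal_orbit_meets (x : X) (U : set X) : minimal T -> open U -> U !=set0 ->
  exists n, U (iter n T x) \/ exists2 z, iter n T z = x & U z.
Proof.
move=> Tmin oU U0; have [w [Uw [n [wE|xE]]]] := Tmin x U U0 oU.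
  by exists n; left; rewrite -wE.
by exists n; right; exists w.
Qed.

End MinimalSets.

Section SkewProduct.
Variables (R : realType) (l : int) (alpha : R) (f : R -> R).
Hypothesis f_lift : lifts l f.
Local Notation torus := (circle R * circle R)%type.
Local Notation T := (skew_product alpha f).

Lemma skew_tpi x y : T (tpi x y) = tpi (x + alpha) (f x + y).
Proof. by rewrite /tpi /cpi (skew_product_pi _ _ _ f_lift). Qed.

Lemma iter_skew_tpi n x y :
  iter n T (tpi x y) = tpi (x + n%:R * alpha) (birkhoff alpha f n x + y).
Proof.
elim: n => [|n IHn]; first by rewrite mul0r addr0 birkhoff0 add0r.
rewrite iterS IHn skew_tpi birkhoffS -[n.+1%:R]natr1.
by congr tpi; ring.
Qed.

Lemma skew_continuous : continuous T.
Proof.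
apply: torus_continuous => /= v.
rewrite (_ : (fun v => _) =
    (fun v : R * R => tpi v.1 v.2) \o (fun v => (v.1 + alpha, f v.1 + v.2))).
  apply: continuous_comp; last exact: tpi_continuous.
  apply: (@pair_continuous_at _ _ _ (fun v : R * R => v.1 + alpha)
                                    (fun v => f v.1 + v.2)).
    by apply: cvgD; [exact: fst_continuous|exact: cvg_cst].
  apply: cvgD; last exact: snd_continuous.
  by apply: continuous_comp; [exact: fst_continuous|exact: f_lift.1].
by apply/funext => w /=; rewrite skew_tpi.
Qed.

Lemma skew_vrot t s : T (vrot t s) = vrot t (T s).
Proof.
by have [x [y ->]] := tpi_surj s; rewrite vrot_tpi !skew_tpi vrot_tpi addrA.
Qed.

Lemma iter_skew_vrot n t s : iter n T (vrot t s) = vrot t (iter n T s).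
Proof. by elim: n => //= n ->; rewrite skew_vrot. Qed.

Lemma skew_fst s : (T s).1 = rot alpha s.1.
Proof. by have [x [y ->]] := tpi_surj s; rewrite skew_tpi /= rot_cpi. Qed.

End SkewProduct.

Lemma skew_homeomorphism (R : realType) (l : int) (alpha : R) (f : R -> R) :
  lifts l f -> homeomorphism (skew_product alpha f).
Proof.
move=> fl; split; first exact: (skew_continuous fl).
pose g x := - f (x - alpha).
have gl : lifts (- l) g.
  split.
    move=> x; apply: cvgN; apply: continuous_comp; last exact: fl.1.
    by apply: cvgB; [exact: cvg_id|exact: cvg_cst].
  by move=> x; have := fl.2 (x - alpha); rewrite /g intrN addrAC; lra.
exists (skew_product (- alpha) g); split; last exact: (skew_continuous gl).
  move=> s; have [x [y ->]] := tpi_surj s.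
  by rewrite (skew_tpi _ fl) (skew_tpi _ gl) /g addrK addKr.
move=> s; have [x [y ->]] := tpi_surj s.
by rewrite (skew_tpi _ gl) (skew_tpi _ fl) /g subrK addNKr.
Qed.

Section AffineMinimality.
Variables (R : realType) (l : int) (alpha c : R).
Hypothesis l_neq0 : l != 0.
Hypothesis alpha_irr : irrational alpha.
Local Notation torus := (circle R * circle R)%type.

Definition affine_lift (x : R) : R := l%:~R * x + c.

Lemma affine_lift_lifts : lifts l affine_lift.
Proof.
split; last by move=> x; rewrite /affine_lift; ring.
move=> x; apply: cvgD; last exact: cvg_cst.
by apply: cvgM; [exact: cvg_cst|exact: cvg_id].
Qed.

Local Notation T := (skew_product alpha affine_lift).

Lemma birkhoff_affine n x h : birkhoff alpha affine_lift n (x + h) =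
  birkhoff alpha affine_lift n x + n%:R * (l%:~R * h).
Proof.
have -> : n%:R * (l%:~R * h) = \sum_(i < n) (l%:~R * h).
  by rewrite sumr_const card_ord mulr_natl.
by rewrite -big_split; apply: eq_bigr => i _ /=; rewrite /affine_lift; ring.
Qed.

Lemma closed_forward_invariant_fst (A : set torus) : closed A ->
  forward_invariant T A -> A !=set0 -> forall z, exists w, A (z, w).
Proof.
move=> clA invA [s As]; have [x [y sE]] := tpi_surj s.
pose B := fst @` A.
have clB : closed B.
  apply: compact_closed; first exact: circle_hausdorff.
  apply: continuous_compact.
    by apply: continuous_subspaceT; exact: fst_continuous.
  by apply: (subclosed_compact clA (@torus_compact R)).
move=> z; suff : B z by move=> [[z' w] Aw <-]; exists w.
have [t zE] := cpi_surj z; apply: clB => D; rewrite zE => /nbhs_cpi[e e0 eD].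
have [n [k nk]] := rotation_dense alpha_irr (t - x) e0.
exists (cpi (x + n%:R * alpha)); split.
  exists (iter n T (tpi x y)).
    by apply: forward_invariant_iter => //; rewrite -sE.
  by rewrite (iter_skew_tpi _ affine_lift_lifts).
rewrite -(cpi_addint _ k); apply: eD; apply: le_lt_trans nk.
by rewrite le_eqVlt; apply/orP; left; apply/eqP; congr `|_|; ring.
Qed.

(** Orbits of two points whose first coordinates differ by [s / (l * n)] drift
    apart vertically by exactly [s] in time [n]. In a minimal closed invariant
    set the vertical translations joining two of its points preserve it; in the
    limit [n -> oo] the drift makes every [s] such a translation. *)
Lemma affine_minimal : minimal T.
Proof.
move=> p O O0 oO.
pose C := closure [set iter n T p | n in [set: nat]].
have invC : forward_invariant T C.
  move=> z Cz D nD.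
  have [_ [[n _ <-] TD]] := Cz _ (skew_continuous affine_lift_lifts nD).
  by exists (iter n.+1 T p); split => //; exists n.+1.
have C0 : C !=set0 by exists p; apply: subset_closure; exists 0%N.
have clC : closed C by exact: closed_closure.
have [A [AC clA invA A0 minA]] :=
  minimal_forward_invariant (@torus_compact R) clC invC C0.
suff AT : forall z, A z.
  have [z Oz] := O0; have nO : nbhs z O by exact: open_nbhs_nbhs.
  have [_ [[n _ <-] On]] := AC z (AT z) O nO.
  by exists (iter n T p); split => //; exists n; left.
(* By minimality [A] is contained in its translate by [- t], which it meets. *)
have joining q t : A q -> A (vrot t q) -> forall z, A z -> A (vrot t z).
  move=> Aq Atq; suff sub : A `<=` A `&` vrot t @^-1` A by move=> z /sub[].
  apply: minA.
  - by move=> ? [].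
  - apply: closedI => //; apply: closed_comp => //.
    by move=> ? _; exact: vrot_continuous.
  - move=> w [Aw Atw]; split; first exact: invA.
    by rewrite /= -(skew_vrot _ affine_lift_lifts); exact: invA.
  - by exists q.
suff vinv s : forall z, A z -> A (vrot s z).
  move=> [z w]; have [w' Aw'] := closed_forward_invariant_fst clA invA A0 z.
  by have [b ->] := rot_trans w' w; exact: (vinv b _ Aw').
have [p0 Ap0] := A0; have [x [y p0E]] := tpi_surj p0; rewrite p0E in Ap0.
pose h (N : nat) := s / (l%:~R * N.+1%:R).
have lh N : N.+1%:R * (l%:~R * h N) = s.
  by rewrite /h; field; rewrite intr_eq0 l_neq0 addrC natr1 pnatr_eq0.
have h0 e : 0 < e -> exists K, forall N, (K <= N)%N -> `|h N| < e.
  move=> e0; exists (Num.truncn (`|s| / e)) => N KN.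
  have l1 : 1 <= `|l%:~R : R| by rewrite -intr_norm ler1z -gtz0_ge1 normr_gt0.
  rewrite /h normrM normfV normrM [`|_.+1%:R|]ger0_norm // ltr_pdivrMr; last first.
    by rewrite mulr_gt0 // (lt_le_trans ltr01).
  apply: (@lt_le_trans _ _ (e * N.+1%:R)).
    rewrite mulrC -ltr_pdivrMr //; apply: (lt_le_trans (truncnS_gt _)).
    by rewrite ler_nat ltnS.
  by rewrite ler_pM2l // ler_peMl.
have /choice[w Aw] N : exists w, A (cpi (x + h N), w).
  exact: closed_forward_invariant_fst.
(* [(q, w')] is a cluster point, as [N] goes to infinity, of the time [N + 1] image
   of the first point and the height at which the second one starts. *)
pose v N := (iter N.+1 T (tpi x y), w N).
have cptTC : compact [set: torus * circle R].
  by rewrite -setXTT; apply: compact_setX; [exact: torus_compact|exact: circle_compact].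
have [[q w'] [_ clv]] := cptTC (v @ \oo) _ filterT.
have [a [b qE]] := tpi_surj q; have [y' w'E] := cpi_surj w'.
have often e (K : nat) : 0 < e -> exists N a' b' v', [/\ (K <= N)%N,
    [/\ `|a' - a| < e, `|b' - b| < e & `|v' - y'| < e],
    iter N.+1 T (tpi x y) = tpi a' b' & w N = cpi v'].
  move=> e0.
  pose B := [set s : torus | exists a' b',
    [/\ `|a' - a| < e, `|b' - b| < e & s = tpi a' b']].
  pose D := [set z : circle R | exists2 v', `|v' - y'| < e & z = cpi v'].
  have nBD : nbhs (q, w') (B `*` D).
    exists (B, D) => //=; split.
      by rewrite qE; apply/nbhs_tpi; exists e => // a' b' ? ?; exists a', b'.
    by rewrite w'E; apply/nbhs_cpi; exists e => // v' ?; exists v'.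
  have nK : (v @ \oo) [set v N | N in [set N | (K <= N)%N]].
    by exists K => // N /= KN; exists N.
  have [_ [[N KN <-] [[a' [b' [aa' bb' TE]]] [v' vv' wE]]]] := clv _ _ nK nBD.
  by exists N, a', b', v'; split.
have near_A a1 b1 : (forall e, 0 < e -> exists a' b',
    [/\ `|a' - a1| < e, `|b' - b1| < e & A (tpi a' b')]) -> A (tpi a1 b1).
  move=> ex; apply: clA => D /nbhs_tpi[e e0 eD].
  have [a' [b' [aa' bb' Aab]]] := ex e e0.
  by exists (tpi a' b'); split => //; exact: eD.
(* The three limit points in [A]: one at height [y'] above [x], then the limits
   of the images of the two points, whose heights differ by [y' - y + s]. *)
have Axy' : A (tpi x y').
  apply: near_A => e e0; have [K hK] := h0 e e0.
  have [N [_ [_ [v' [KN [_ _ vv'] _ wE]]]]] := often e K e0.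
  exists (x + h N), v'; split => //; first by rewrite addrC addKr hK.
  by rewrite /tpi -wE.
have Aq : A (tpi a b).
  apply: near_A => e e0.
  have [N [a' [b' [_ [_ [aa' bb' _] TE _]]]]] := often e 0%N e0.
  by exists a', b'; split => //; rewrite -TE; apply: forward_invariant_iter.
have Aq' : A (tpi a (b + (y' - y + s))).
  apply: near_A => e e0; have e20 : 0 < e / 2 by rewrite divr_gt0.
  have [K hK] := h0 _ e20.
  have [N [a' [b' [v' [KN [aa' bb' vv'] TE wE]]]]] := often _ K e20.
  exists (a' + h N), (b' + (v' - y + s)); split.
  - have -> : a' + h N - a = (a' - a) + h N by ring.
    apply: le_lt_trans (ler_normD _ _) _.
    by have := hK N KN; lra.
  - have -> : b' + (v' - y + s) - (b + (y' - y + s)) = (b' - b) + (v' - y') by ring.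
    by apply: le_lt_trans (ler_normD _ _) _; lra.
  suff <- : iter N.+1 T (tpi (x + h N) v') = tpi (a' + h N) (b' + (v' - y + s)).
    by apply: forward_invariant_iter => //; rewrite /tpi -wE.
  move: TE; rewrite !(iter_skew_tpi _ affine_lift_lifts) => -[E1 E2].
  rewrite birkhoff_affine lh /tpi; congr pair.
    by rewrite addrAC -(rot_cpi (h N)) E1 rot_cpi.
  by rewrite -(rot_cpi _ b') -E2 rot_cpi; congr cpi; ring.
have Rts := joining _ (y' - y + s) Aq; rewrite vrot_tpi in Rts.
have Rt := joining _ (y - y') Axy'; rewrite vrot_tpi addrC subrK in Rt.
move=> z Az.
have -> : vrot s z = vrot (y - y') (vrot (y' - y + s) z).
  by rewrite /vrot /= rotD; congr (_, rot _ _); ring.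
by apply: (Rt Ap0); apply: (Rts Aq').
Qed.

End AffineMinimality.

(** * Inverse limits *)

Section InverseLimits.

(** Threads are extended upwards from level [i] by surjectivity. The dependent
    types make induction on [i], shifting the whole system by one level, simpler
    than filling in the lower levels at once. *)
Lemma inverse_limit_surj (i : nat) : forall (Y : nat -> topologicalType)
    (p : forall j, Y j.+1 -> Y j),
  (forall j, set_surj [set: Y j.+1] [set: Y j] (p j)) ->
  forall y : Y i, exists x : inverse_limit p, set_val x i = y.
Proof.
elim: i => [|i IHi] Y p surj y.
  have lift j : forall u : Y j, exists v, p j v = u.
    by move=> u; have [v _ <-] := surj j u Logic.I; exists v.
  pose up j (u : Y j) := sval (cid (lift j u)).
  have upK j u : p j (up j u) = u by rewrite /up; case: cid.
  pose x : forall j, Y j := fix x j := if j is j'.+1 then up j' (x j') else y.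
  have xP : inverse_limit p x by move=> j; exact: upK.
  by exists (exist _ (x : prod_topology Y) (mem_set xP)).
have [x xi] := IHi (fun j => Y j.+1) (fun j => p j.+1) (fun j => surj j.+1) y.
pose z : forall j, Y j := fun j =>
  if j is j'.+1 then set_val x j' else p 0%N (set_val x 0%N).
have zP : inverse_limit p z.
  by case=> [|j] //=; have := set_valP x j.
by exists (exist _ (z : prod_topology Y) (mem_set zP)).
Qed.

Lemma prod_topology_cvg (K : nat -> topologicalType)
    (F : set_system (prod_topology K)) (g : prod_topology K) : Filter F ->
  (forall i V, nbhs (g i) V -> F [set u | V (u i)]) -> F --> g.
Proof.
move=> FF Fi; apply/cvg_sup => i U [V] [[W] oW <-] Wg WU.
apply: (filterS WU); apply: Fi; exact: open_nbhs_nbhs.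
Qed.

Lemma inverse_limit_coord_continuous (Y : nat -> topologicalType)
    (p : forall j, Y j.+1 -> Y j) (i : nat) :
  continuous (fun x : inverse_limit p => set_val x i).
Proof.
move=> x; apply: (@continuous_comp _ _ _ (@set_val _ (inverse_limit p)) (@proj _ Y i)).
  exact: initial_continuous.
exact: proj_continuous.
Qed.

(** A neighborhood in a product depends on finitely many coordinates only, and
    each coordinate of a thread determines the lower ones, so that a single
    coordinate suffices to recognize a neighborhood. *)
Lemma inverse_limit_factors (X : topologicalType) (T : X -> X)
    (Y : nat -> topologicalType) (S : forall i, Y i -> Y i)
    (p : forall i, Y i.+1 -> Y i) : is_inverse_limit T S p ->
  exists q : forall i, X -> Y i, (forall i, factor_map T (S i) (q i)) /\
    forall x U, nbhs x U -> exists i V, nbhs (q i x) V /\ q i @^-1` V `<=` U.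
Proof.
move=> [pfac [h [[hc [g [hK gK gc]]] hT]]].
exists (fun i x => set_val (h x) i); split.
  move=> i; split; last by move=> x; exact: hT.
    move=> x; apply: (@continuous_comp _ _ _ h (fun z => set_val z i)); first exact: hc.
    exact: inverse_limit_coord_continuous.
  move=> y _.
  have [z zy] := @inverse_limit_surj i Y p (fun j => let: And3 _ s _ := pfac j in s) y.
  by exists (g z) => //=; rewrite gK.
move=> x U; rewrite -{1}(hK x) => /gc nU.
pose q i x := set_val (h x) i.
have qp i z : p i (q i.+1 z) = q i z := set_valP (h z) i.
have pc i : continuous (p i) by case: (pfac i).
(* [B] is the neighborhood filter of [x] for the topology induced by the
   coordinates; it converges to [x] because [h] has a continuous inverse. *)
pose B := [set W : set X | exists i V, nbhs (q i x) V /\ q i @^-1` V `<=` W].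
have up i j V : nbhs (q i x) V -> (i <= j)%N ->
    exists2 V', nbhs (q j x) V' & q j @^-1` V' `<=` q i @^-1` V.
  move=> nV ij; rewrite -(subnK ij); elim: (j - i)%N => [|k [V' nV' sV']].
    by exists V.
  exists (p (k + i)%N @^-1` V').
    by apply: pc; rewrite qp.
  by move=> z /=; rewrite qp => /sV'.
have BF : Filter B.
  split.
  - by exists 0%N, setT; split => //; exact: filterT.
  - move=> W1 W2 [i [V [nV sV]]] [j [V' [nV' sV']]].
    have [V1 nV1 sV1] := up _ _ _ nV (leq_maxl i j).
    have [V2 nV2 sV2] := up _ _ _ nV' (leq_maxr i j).
    exists (maxn i j), (V1 `&` V2); split; first exact: filterI.
    by move=> z [/sV1/sV Wz /sV2/sV' Wz'].
  - by move=> W W' WW' [i [V [nV sV]]]; exists i, V; split => // z /sV/WW'.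
have hB W : nbhs (h x) W -> B (h @^-1` W).
  move=> [W' [[D oD <-] Dx] DW].
  have cvgB := @prod_topology_cvg Y (fmap (set_val \o h) B) (set_val (h x)).
  have : fmap (set_val \o h) B D.
    apply: cvgB; first by move=> i V nV; exists i, V; split; [exact: nV|move=> z].
    exact: open_nbhs_nbhs.
  by move=> [i [V [nV sV]]]; exists i, V; split => // z /sV Dz; exact: DW.
have [i [V [nV sV]]] := hB _ nU.
by exists i, V; split => // z /sV /=; rewrite hK.
Qed.

End InverseLimits.

(** * Coset spaces of topological groups *)

Section CosetTopology.
Variables (G : topologicalGroupType) (Gamma : subgroup G).
Local Open Scope group_scope.
Local Open Scope quotient_scope.
Local Notation Y := (coset_space Gamma).
Implicit Types (g h u : G).

Definition cospi (g : G) : Y := \pi_Y g.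

Lemma cospi_surj (y : Y) : exists g, y = cospi g.
Proof. by exists (repr y); rewrite /cospi reprK. Qed.

Lemma cospiP g h : cospi g = cospi h <-> subgroup_set Gamma (g^-1 * h).
Proof.
split=> [/coset_piP/asboolP //|gh].
by apply/coset_piP/asboolP.
Qed.

Lemma mulg_continuous_at g h (U : set G) : nbhs (g * h) U ->
  exists2 VW : set G * set G, nbhs g VW.1 /\ nbhs h VW.2 &
    forall v w, VW.1 v -> VW.2 w -> U (v * w).
Proof.
move=> /(@mulg_continuous G (g, h))[[V W] /= nVW VWU].
by exists (V, W) => // v w Vv Ww; exact: (VWU (v, w)).
Qed.

Lemma mulg_continuousr h : continuous (fun g => g * h).
Proof.
move=> g U /mulg_continuous_at[[V W] /= [nV nW] VWU].
by apply: filterS nV => v Vv; apply: VWU => //; exact: nbhs_singleton.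
Qed.

Lemma cospi_continuous : continuous cospi.
Proof. exact: pi_continuous. Qed.

Lemma nbhs_cospi g (A : set Y) : nbhs (cospi g) A <-> nbhs g (cospi @^-1` A).
Proof.
split; first exact: cospi_continuous.
rewrite nbhsE => -[V [oV Vg] VA].
have oU : open (cospi @` V).
  rewrite /open /= /quotient_open.
  have -> : \pi_Y @^-1` (cospi @` V) =
      \bigcup_(c in subgroup_set Gamma) [set h | V (h * c)].
    apply/seteqP; split => h /=.
      move=> [v Vv /esym/cospiP hv]; exists (h^-1 * v) => //=.
      by rewrite mulVKg.
    move=> [c cG /= Vhc]; exists (h * c) => //; apply/esym/cospiP.
    by rewrite mulKg.
  apply: bigcup_open => c _.
  by apply: open_comp => // h _; exact: mulg_continuousr.
apply: (@filterS _ _ _ (cospi @` V)); first by move=> _ [v Vv <-]; exact: VA.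
by apply: open_nbhs_nbhs; split => //; exists g.
Qed.

Lemma coset_continuous (Z : topologicalType) (k : Y -> Z) :
  continuous (k \o cospi) -> continuous k.
Proof. by move=> kc; apply/quotient_continuous. Qed.

(** If two points of the subgroup are close to a common point, their quotient is
    close to the identity, which is isolated in the subgroup, so they coincide.
    Hence near any point there is at most one point of the subgroup. *)
Lemma discrete_subgroup_closed : hausdorff_space G ->
  isolated (subgroup_set Gamma) = subgroup_set Gamma ->
  closed (subgroup_set Gamma).
Proof.
move=> hG disc x clx; have [G1 GM GV] := subgroupP Gamma.
have [_ [U nU U1]] : isolated (subgroup_set Gamma) 1 by rewrite disc.
have nxx : nbhs (x^-1 * x) U by rewrite mulVg.
have [[V W] /= [nV nW] VWU] := mulg_continuous_at nxx.
have nV' : nbhs x [set v | V v^-1] by exact: invg_continuous nV.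
pose B := [set v | V v^-1] `&` W.
have nB : nbhs x B by exact: filterI.
have uniq a b : subgroup_set Gamma a -> subgroup_set Gamma b -> B a -> B b -> a = b.
  move=> Ga Gb [Va _] [_ Wb].
  have : (U `&` subgroup_set Gamma) (a^-1 * b).
    by split; [exact: VWU|apply: GM => //; exact: GV].
  by rewrite U1 => /= ab; rewrite -[a]mulg1 -ab mulVKg.
have [a [Ga Ba]] := clx B nB.
suff <- : a = x by [].
apply: hG => A C nA nC.
have [b [Gb [Bb Cb]]] := clx _ (filterI nB nC).
by exists a; split; [exact: nbhs_singleton|rewrite (uniq a b)].
Qed.

Lemma coset_hausdorff : closed (subgroup_set Gamma) -> hausdorff_space Y.
Proof.
move=> clG y z yz; have [g yE] := cospi_surj y; have [h zE] := cospi_surj z.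
rewrite yE zE in yz *; apply/cospiP; apply: clG => U.
move=> /mulg_continuous_at[[V W] /= [nV nW] VWU].
have nV' : nbhs g [set v | V v^-1] by exact: invg_continuous nV.
have [||c [[v Vv vE] [w Ww wE]]] := yz (cospi @` [set v | V v^-1]) (cospi @` W).
- by apply/nbhs_cospi; apply: filterS nV' => v; exists v.
- by apply/nbhs_cospi; apply: filterS nW => v; exists v.
exists (v^-1 * w); split; last exact: VWU.
by apply/cospiP; rewrite vE wE.
Qed.

Definition act (u : G) (y : Y) : Y := coset_translation u y.

Lemma act_cospi u g : act u (cospi g) = cospi (u * g).
Proof. exact: coset_translation_pi. Qed.

Lemma actM u v y : act (u * v) y = act u (act v y).
Proof. by have [g ->] := cospi_surj y; rewrite !act_cospi mulgA. Qed.

Lemma act1 y : act 1 y = y.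
Proof. by have [g ->] := cospi_surj y; rewrite act_cospi mul1g. Qed.

Lemma act_continuous : continuous (fun uy : G * Y => act uy.1 uy.2).
Proof.
move=> [u y] U /=; have [g ->] := cospi_surj y; rewrite act_cospi.
move=> /nbhs_cospi/mulg_continuous_at[[V W] /= [nV nW] VWU].
exists (V, cospi @` W) => /=.
  by split => //; apply/nbhs_cospi; apply: filterS nW => w; exists w.
by move=> [v _] [/= Vv [w Ww <-]]; rewrite act_cospi; exact: VWU.
Qed.

(** Orbit maps are open, being composed of a translation of the group and of the
    projection to the cosets. *)
Lemma act_open (y : Y) (V : set G) : nbhs 1 V ->
  nbhs y [set z | exists2 u, V u & z = act u y].
Proof.
have [g ->] := cospi_surj y => nV; apply/nbhs_cospi.
have : nbhs g [set h | V (h * g^-1)].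
  by apply: (@mulg_continuousr g^-1); rewrite mulgV.
apply: filterS => h /= Vh; exists (h * g^-1) => //.
by rewrite act_cospi mulgVK.
Qed.

End CosetTopology.

Section TwoStepGroups.
Local Open Scope group_scope.
Variable G : groupType.

Lemma lower_central_subgroup (j : nat) : is_subgroup (@lower_central G j).
Proof.
case: j => [|j] //=; split.
- by move=> A [[A1 _ _] _].
- by move=> x y Sx Sy A AP; have [[_ AM _] _] := AP; apply: AM; [apply: Sx|apply: Sy].
- by move=> x Sx A AP; have [[_ _ AV] _] := AP; apply: AV; apply: Sx.
Qed.

Lemma commutator_lower_central (j : nat) (a b : G) :
  lower_central j a -> lower_central j.+1 [~ a, b].
Proof. by move=> aj A [_ AP]; apply: AP; exists (a, b). Qed.

Lemma two_step_commutator_central (a b c : G) : nilpotent_step G 2 ->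
  commute [~ a, b] c.
Proof.
move=> nil2; have : lower_central 2 [~ [~ a, b], c].
  by do 2 apply: commutator_lower_central.
by rewrite nil2 /= => /eqP/commgP.
Qed.

End TwoStepGroups.

(** * From nilsystems to coboundaries *)

Lemma closed_equalizer (X Y : topologicalType) (f g : X -> Y) :
  hausdorff_space Y -> continuous f -> continuous g -> closed [set x | f x = g x].
Proof.
move=> hY fc gc x clx; apply: hY => A B nA nB.
have nAB : nbhs x (f @^-1` A `&` g @^-1` B).
  by apply: filterI; [exact: fc|exact: gc].
have [z [/= fgz [Az Bz]]] := clx _ nAB.
by exists (f z); split => //; rewrite fgz.
Qed.

Lemma compact_bijection_inverse (X Y : topologicalType) (q : X -> Y) (r : Y -> X) :
  compact [set: X] -> hausdorff_space Y -> continuous q ->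
  cancel q r -> cancel r q -> continuous r.
Proof.
move=> cptX hY qc qK rK; apply/continuous_closedP => C clC.
have -> : r @^-1` C = q @` C.
  apply/seteqP; split => y /=; first by exists (r y).
  by move=> [x Cx <-]; rewrite qK.
apply: compact_closed => //; apply: continuous_compact.
  exact: continuous_subspaceT.
by apply: (subclosed_compact clC cptX).
Qed.

Section SmallFactor.
Variables (R : realType) (l : int) (alpha : R) (f : R -> R).
Hypothesis f_lift : lifts l f.
Local Notation torus := (circle R * circle R)%type.
Local Notation T := (skew_product alpha f).
Hypothesis T_min : minimal T.
Variables (Y : topologicalType) (S : Y -> Y) (q : torus -> Y).
Hypothesis Y_hausdorff : hausdorff_space Y.
Hypothesis S_inj : injective S.
Hypothesis q_cont : continuous q.
Hypothesis qT : forall s, q (T s) = S (q s).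
Variable V : set Y.
Hypothesis V_nbhs : nbhs (q (tpi 0 0)) V.
Hypothesis V_small : forall s, V (q s) ->
  exists a b, [/\ `|a| <= 10^-1, `|b| <= 10^-1 & s = tpi a b].

Lemma rot_inj a : injective (@rot R a).
Proof.
move=> z w; have [x ->] := cpi_surj z; have [y ->] := cpi_surj w.
by rewrite !rot_cpi; exact: cpi_cancel.
Qed.

Lemma skew_bij : injective T /\ forall s, exists z, T z = s.
Proof.
have [_ [g [gK Kg _]]] := skew_homeomorphism alpha f_lift.
by split; [exact: can_inj gK|move=> s; exists (g s)].
Qed.

Lemma iter_skew_inj n : injective (iter n T).
Proof.
elim: n => [|n IHn] s s' //= /(skew_bij.1); exact: IHn.
Qed.

Lemma iter_skew_surj n s : exists z, iter n T z = s.
Proof.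
elim: n s => [|n IHn] s; first by exists s.
have [z Tz] := skew_bij.2 s; have [w wz] := IHn z.
by exists w; rewrite iterS wz.
Qed.

Lemma iter_skew_fst n s : (iter n T s).1 = rot (n%:R * alpha) s.1.
Proof.
have [x [y ->]] := tpi_surj s.
by rewrite (iter_skew_tpi _ f_lift) /= rot_cpi.
Qed.

Lemma q_iter n s : q (iter n T s) = iter n S (q s).
Proof. by elim: n => //= n <-; rewrite qT. Qed.

Lemma iter_S_inj n : injective (iter n S).
Proof. by elim: n => [|n IHn] s s' //= /S_inj/IHn. Qed.

(** By minimality two points with the same image can be moved simultaneously to
    the base point; there both are close to it, while the horizontal, or
    vertical, displacement between them has not changed. *)
Lemma same_image_small s s' : q s = q s' ->
  (forall b, s'.1 = rot b s.1 -> distZ b <= 5^-1) /\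
  (forall t, s' = vrot t s -> distZ t <= 5^-1).
Proof.
move=> qss'.
have [n H] : exists n, V^° (q (iter n T s)) \/ exists2 z, iter n T z = s & V^° (q z).
  apply: (minimal_orbit_meets s (U := q @^-1` V^°)) => //.
    by apply: open_comp; [move=> ? _; exact: q_cont|exact: open_interior].
  by exists (tpi 0 0); rewrite /= /interior.
have [z [z' [qzz' Vz b1 t1]]] : exists z z', [/\ q z = q z', V (q z),
    forall b, s'.1 = rot b s.1 -> z'.1 = rot b z.1 &
    forall t, s' = vrot t s -> z' = vrot t z].
  case: H => [/interior_subset Vn|[z zs /interior_subset Vz]].
    exists (iter n T s), (iter n T s'); split => //.
    - by rewrite !q_iter qss'.
    - by move=> b sb; rewrite !iter_skew_fst sb rotC.
    - by move=> t ->; rewrite (iter_skew_vrot _ f_lift).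
  have [z' zs'] := iter_skew_surj n s'; exists z, z'; split => //.
  - by apply: (@iter_S_inj n); rewrite -!q_iter zs zs'.
  - move=> b; rewrite -zs -zs' !iter_skew_fst rotC; exact: rot_inj.
  - move=> t; rewrite -zs -zs' -(iter_skew_vrot _ f_lift); exact: iter_skew_inj.
have [a [b [a10 b10 zE]]] := V_small Vz.
have [a' [b' [a10' b10' zE']]] : exists a b,
    [/\ `|a| <= 10^-1, `|b| <= 10^-1 & z' = tpi a b].
  by apply: V_small; rewrite -qzz'.
(* Two points within 1/10 of the base point differ by at most 1/5, the bound
   within which the multiples of a nontrivial translation do not all stay. *)
have small u v : `|u| <= 10^-1 -> `|v| <= 10^-1 -> distZ (u - v) <= 5^-1 :> R.
  move=> u10 v10; apply: le_trans (distZ_le _) _.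
  by apply: le_trans (ler_normB _ _) _; lra.
split=> [c /b1|c /t1]; rewrite zE zE'.
  rewrite /= rot_cpi => /cpiP ac; rewrite -(@distZ_modZ _ (a' - a) c) ?small //.
  by move: ac; rewrite /modZ_rel; congr (_ \is a _); ring.
rewrite vrot_tpi => -[_ /cpiP bc].
rewrite -(@distZ_modZ _ (b' - b) c) ?small //.
by move: bc; rewrite /modZ_rel; congr (_ \is a _); ring.
Qed.

(** The horizontal displacements occurring between points with the same image
    form a subgroup of the circle, and so do the vertical ones; both consist of
    small elements only, hence are trivial. *)
Lemma small_factor_injective : injective q.
Proof.
have hor s s' b : q s = q s' -> s'.1 = rot b s.1 -> b \is a Num.int.
  move=> qss' sb.
  pose A := [set z : torus | exists w, q z = q (rot b z.1, w)].
  have A_all : forall z, A z.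
    apply: (minimal_closed_invariant (T := T) (A := A) (x := s)) => //.
    - pose D := [set zw : torus * circle R | q zw.1 = q (rot b zw.1.1, zw.2)].
      have -> : A = fst @` D.
        apply/seteqP; split => [z [w zw]|_ [[z w] zw <-]]; last by exists w.
        by exists (z, w).
      apply: compact_closed; first exact: torus_hausdorff.
      apply: continuous_compact.
        by apply: continuous_subspaceT; exact: fst_continuous.
      apply: (@subclosed_compact _ _ setT) => //; last first.
        by rewrite -setXTT; apply: compact_setX; [exact: torus_compact|exact: circle_compact].
      apply: closed_equalizer => // zw.
        by apply: continuous_comp; [exact: fst_continuous|exact: q_cont].
      apply: continuous_comp; last exact: q_cont.
      apply: (@pair_continuous_at _ _ _ (fun zw : torus * circle R => rot b zw.1.1) snd).
        apply: continuous_comp; last exact: rot_continuous.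
        by apply: continuous_comp; exact: fst_continuous.
      exact: snd_continuous.
    - move=> z; split=> -[w zw].
        have [u uw] := skew_bij.2 (rot b (T z).1, w).
        have u1 : u.1 = rot b z.1.
          apply: (@rot_inj alpha); rewrite -(skew_fst _ f_lift) uw.
          by have -> := skew_fst alpha f_lift z; rewrite rotC.
        exists u.2; rewrite -u1 -surjective_pairing; apply: S_inj.
        by rewrite -!qT uw.
      exists (T (rot b z.1, w)).2.
      have -> : rot b (T z).1 = (T (rot b z.1, w)).1.
        by rewrite !(skew_fst _ f_lift) rotC.
      by rewrite -surjective_pairing !qT zw.
    - by exists s'.2; rewrite -sb -surjective_pairing.
  apply: int_small_multiples => n.
  have [w zw] : exists w, q (tpi 0 0) = q (rot (n%:R * b) (tpi 0 0 : torus).1, w).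
    elim: n => [|n [w ->]].
      by exists (cpi 0); rewrite mul0r rot0.
    have [w' ->] := A_all (rot (n%:R * b) (tpi 0 0 : torus).1, w).
    by exists w'; rewrite rotD /= -[n.+1%:R]natr1 mulrDl mul1r.
  by have [h _] := same_image_small zw; exact: h.
move=> s s' qss'.
have [b sb] := rot_trans s.1 s'.1.
have {sb} s1 : s'.1 = s.1 by rewrite sb; apply/rot_fix/(hor _ _ _ qss').
have [t st] := rot_trans s.2 s'.2.
have {s1 st} st : s' = vrot t s by rewrite /vrot -st -s1 -surjective_pairing.
have vert_all : forall z, q z = q (vrot t z).
  pose A := [set z : torus | q z = q (vrot t z)].
  apply: (minimal_closed_invariant (T := T) (A := A) (x := s)) => //.
  - apply: closed_equalizer => // z.
    by apply: continuous_comp; [exact: vrot_continuous|exact: q_cont].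
  - move=> z; rewrite /A /= -(skew_vrot _ f_lift) !qT; split; first exact: S_inj.
    by move=> ->.
  - by rewrite /A /= -st.
suff /rot_fix tint : t \is a Num.int by rewrite st /vrot tint -surjective_pairing.
apply: int_small_multiples => n.
have zw : q (tpi 0 0) = q (vrot (n%:R * t) (tpi 0 0)).
  elim: n => [|n ->]; first by rewrite mul0r /vrot rot0.
  by rewrite vert_all /vrot rotD -[n.+1%:R]natr1 mulrDl mul1r.
by have [_ h] := same_image_small zw; exact: h.
Qed.

End SmallFactor.

Section NilToCoboundary.
Variables (R : realType) (l : int) (alpha : R) (f : R -> R).
Hypothesis f_lift : lifts l f.
Local Notation torus := (circle R * circle R)%type.
Local Notation T := (skew_product alpha f).
Hypothesis T_min : minimal T.
Variables (G : topologicalGroupType) (Gamma : subgroup G) (tau : G).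
Local Notation Y := (coset_space Gamma).
Hypothesis G_nil : nilpotent_step G 2.
Variables (q : torus -> Y) (r : Y -> torus).
Hypotheses (q_cont : continuous q) (r_cont : continuous r).
Hypotheses (qK : cancel q r) (rK : cancel r q).
Hypothesis qT : forall s, q (T s) = act tau (q s).

Definition transport (g : G) (s : torus) : torus := r (act g (q s)).

Lemma transportM g h s : transport (g * h)%g s = transport g (transport h s).
Proof. by rewrite /transport rK actM. Qed.

Lemma transportX g n s : transport (g ^+ n)%g s = iter n (transport g) s.
Proof.
elim: n s => [|n IHn] s; first by rewrite /transport act1 qK.
by rewrite expgS transportM iterS IHn.
Qed.

Lemma transport_tau : transport tau =1 T.
Proof. by move=> s; rewrite /transport -qT qK. Qed.

Lemma transport_pair_continuous :
  continuous (fun us : G * torus => transport us.1 us.2).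
Proof.
move=> us; rewrite /transport.
apply: (@continuous_comp _ _ _ (fun us : G * torus => act us.1 (q us.2)) r);
  last exact: r_cont.
apply: (@continuous_comp _ _ _ (fun us : G * torus => (us.1, q us.2))
                               (fun uy : G * Y => act uy.1 uy.2)).
  apply: (@pair_continuous_at _ _ _ fst (fun us : G * torus => q us.2)).
    exact: fst_continuous.
  by apply: continuous_comp; [exact: snd_continuous|exact: q_cont].
exact: act_continuous.
Qed.

Lemma transport_continuous g : continuous (transport g).
Proof.
move=> s; rewrite /transport.
apply: (@continuous_comp _ _ _ (fun s => act g (q s)) r); last exact: r_cont.
apply: (@continuous_comp _ _ _ (fun s => (g, q s)) (fun uy : G * Y => act uy.1 uy.2)).
  by apply: (@pair_continuous_at _ _ _ (cst g) q); [exact: cvg_cst|exact: q_cont].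
exact: act_continuous.
Qed.

Lemma transport_small (e : R) : 0 < e ->
  \forall u \near (1%g : G), forall s, exists a b,
    [/\ `|a| < e, `|b| < e & transport u s = vrot b (hrot a s)].
Proof.
move=> e0.
pose P (u : G) s := exists a b,
    [/\ `|a| < e, `|b| < e & transport u s = vrot b (hrot a s)].
have near_P s : [set: torus] s -> \forall s' \near s & u \near (1%g : G), P u s'.
  move=> _; have [x [y sE]] := tpi_surj s.
  pose D := [set s' : torus | exists x' y',
    [/\ `|x' - x| < e / 2, `|y' - y| < e / 2 & s' = tpi x' y']].
  have nD : nbhs s D.
    rewrite sE; apply/nbhs_tpi; exists (e / 2); first by rewrite divr_gt0.
    by move=> x' y' ? ?; exists x', y'.
  have := @transport_pair_continuous (1%g, s) D.
  rewrite /= {1}/transport act1 qK => /(_ nD) [[V W] /= [nV nW] VWD].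
  exists (W `&` D, V) => /=; first by split => //; exact: filterI.
  move=> [s' u] [/= [Ws' [x2 [y2 [xx2 yy2 s'E]]]] Vu].
  have [x1 [y1 [xx1 yy1 us'E]]] := VWD (u, s') (conj Vu Ws').
  have half (a b c : R) : `|a - c| < e / 2 -> `|b - c| < e / 2 -> `|a - b| < e.
    move=> ac bc; have -> : a - b = (a - c) - (b - c) by ring.
    by apply: le_lt_trans (ler_normB _ _) _; lra.
  exists (x1 - x2), (y1 - y2); split; [exact: half xx1 xx2|exact: half yy1 yy2|].
  rewrite [LHS]us'E s'E hrot_tpi vrot_tpi.
  by rewrite [x2 + _]addrC subrK [y2 + _]addrC subrK.
have [cov _] := compact_near_coveringP [set: torus].
have := cov (@torus_compact R) G (nbhs (1%g : G)) P (nbhs_filter _) near_P.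
by apply: filter_app; apply: nearW => u Pu s; exact: Pu.
Qed.

(** Write the point [(h, 0)] as the image of [(0, 0)] under a group element [u]
    close to 1. As commutators are central, [tau ^+ n * u] is
    [z ^+ n * u * tau ^+ n] for a central [z]. A map of the torus commuting with
    the minimal map [T] is determined by one of its values as soon as it has the
    shape of a rotation; this makes [z] a vertical rotation, its horizontal part
    being excluded because all its multiples are small. Comparing second
    coordinates, the increments grow linearly modulo 1. *)
Lemma nil_increments (e : R) : 0 < e -> exists2 d, 0 < d & forall h, `|h| < d ->
  exists sigma, forall n, distZ (increment alpha f h n 0 - n%:R * sigma) <= e.
Proof.
(* The bound 1/10 keeps the multiples of the horizontal part of [z] below 1/5. *)
move=> e0; pose e1 := Num.min e (10^-1).
have e10 : 0 < e1 by rewrite lt_min e0 invr_gt0 ltr0n.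
have e1e : e1 <= e by rewrite ge_min lexx.
have e1t : e1 <= 10^-1 by rewrite ge_min lexx orbT.
have : nbhs (tpi 0 0 : torus) (q @^-1` [set z | exists2 u,
    (forall s, exists a b,
      [/\ `|a| < e1, `|b| < e1 & transport u s = vrot b (hrot a s)]) &
    z = act u (q (tpi 0 0))]).
  by apply: q_cont; apply: act_open; exact: transport_small.
move=> /nbhs_tpi[d d0 dP]; exists (Num.min d e1); first by rewrite lt_min d0.
move=> h; rewrite lt_min => /andP[hd he1].
have [||u small_u /(congr1 r)] := dP h 0; rewrite ?subr0 ?normr0 //.
rewrite qK -/(transport u _) => hu.
pose z := [~ tau^-1, u^-1]%g; pose Z := transport z.
have zc (g : G) : commute z g by exact: two_step_commutator_central.
have ZT s : Z (T s) = T (Z s).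
  by rewrite /Z -!transport_tau -!transportM zc.
have tun n : (tau ^+ n * u = z ^+ n * (u * tau ^+ n))%g.
  elim: n => [|n IHn]; first by rewrite !mul1g mulg1.
  rewrite expgS -mulgA IHn mulgA.
  have -> : (tau * z ^+ n = z ^+ n * tau)%g.
    by apply: commute_sym; apply/commute_sym/commuteX/commute_sym; exact: zc.
  have tu : (tau * u = z * (u * tau))%g by exact: commgCV.
  by rewrite -mulgA [(tau * (u * _))%g]mulgA tu expgSr -!mulgA.
have orb n : iter n T (tpi h 0) = iter n Z (transport u (iter n T (tpi 0 0))).
  have iterT m s : iter m T s = transport (tau ^+ m)%g s.
    rewrite transportX; elim: m => //= m ->; by rewrite transport_tau.
  rewrite hu !iterT -transportM tun !transportM (transportX z).
  by [].
have Zc : continuous Z by exact: transport_continuous.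
have [b Zb] := rot_trans (tpi 0 0 : torus).1 (Z (tpi 0 0)).1.
have Zhor : forall s, (Z s).1 = rot b s.1.
  pose A := [set s | (Z s).1 = rot b s.1].
  apply: (minimal_closed_invariant (T := T) (A := A) (x := tpi 0 0)) => //.
    apply: closed_equalizer; first exact: circle_hausdorff.
      by move=> s; apply: continuous_comp; [exact: Zc|exact: fst_continuous].
    by move=> s; apply: continuous_comp; [exact: fst_continuous|exact: rot_continuous].
  move=> s; rewrite /A /= ZT !(skew_fst _ f_lift) rotC; split; first exact: rot_inj.
  by move=> ->.
have b_int : b \is a Num.int.
  apply: int_small_multiples => n.
  have Zn m s : (iter m Z s).1 = rot (m%:R * b) s.1.
    elim: m => [|m IHm]; first by rewrite mul0r rot0.
    by rewrite iterS Zhor IHm rotD -[m.+1%:R]natr1 mulrDl mul1r.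
  have [a [b' [ae _ uE]]] := small_u (iter n T (tpi 0 0)).
  have := congr1 fst (orb n).
  rewrite Zn uE !(iter_skew_tpi _ f_lift) /= !rot_cpi add0r => /cpiP hb.
  rewrite (@distZ_modZ _ _ (h - a)); last first.
    suff : modZ_rel (n%:R * alpha + a + n%:R * b) (h + n%:R * alpha).
      by rewrite /modZ_rel; congr (_ \is a _); ring.
    by rewrite /modZ_rel -opprB rpredN.
  apply: le_trans (distZ_le _) _; apply: le_trans (ler_normB _ _) _; lra.
have [sigma Zs] := rot_trans (tpi 0 0 : torus).2 (Z (tpi 0 0)).2.
have Zver : forall s, Z s = vrot sigma s.
  pose A := [set s | Z s = vrot sigma s].
  apply: (minimal_closed_invariant (T := T) (A := A) (x := tpi 0 0)).
  - by [].
  - apply: closed_equalizer => //; first exact: torus_hausdorff.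
    exact: vrot_continuous.
  - move=> s; rewrite /A /= ZT -(skew_vrot _ f_lift).
    by split=> [/(skew_bij alpha f_lift).1|->].
  - rewrite /A /= /vrot -Zs [RHS]surjective_pairing /=.
    by rewrite [LHS]surjective_pairing Zhor; congr pair; apply/rot_fix.
exists sigma => n.
have Zn m s : iter m Z s = vrot (m%:R * sigma) s.
  elim: m => [|m IHm]; first by rewrite mul0r /vrot rot0 -surjective_pairing.
  by rewrite iterS Zver IHm /vrot rotD -[m.+1%:R]natr1 mulrDl mul1r.
have [a [b' [_ be uE]]] := small_u (iter n T (tpi 0 0)).
have := congr1 snd (orb n).
rewrite Zn uE !(iter_skew_tpi _ f_lift) /= !rot_cpi !addr0 => /cpiP hb.
rewrite /increment add0r (@distZ_modZ _ _ b'); last first.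
  by move: hb; rewrite /modZ_rel; congr (_ \is a _); ring.
by apply: le_trans (distZ_le _) _; lra.
Qed.

End NilToCoboundary.

Lemma order_two_coboundary (R : realType) (l : int) (alpha : R) (f : R -> R) :
  irrational alpha -> lifts l f ->
  system_of_order R 2 (skew_product alpha f) ->
  exists (phi : R -> R) (c : R), lifts 0 phi /\
    forall x : R, f x = l%:~R * x + phi (x + alpha) - phi x + c.
Proof.
move=> alpha_irr f_lift [_ T_min [N [p lim]]].
apply: (linear_increments_coboundary f_lift alpha_irr) => e e0.
have [q [q_fac q_nbhs]] := inverse_limit_factors lim.
pose U := [set s : circle R * circle R | exists a b,
  [/\ `|a| <= 10^-1, `|b| <= 10^-1 & s = tpi a b]].
have nU : nbhs (tpi 0 0) U.
  apply/nbhs_tpi; exists (10^-1); first by rewrite invr_gt0.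
  by move=> x' y'; rewrite !subr0 => /ltW ? /ltW ?; exists x', y'.
have [i [V [nV VU]]] := q_nbhs _ _ nU.
have [qc qs qT] := q_fac i.
have [hG _ _] := nil_lie (N i).
have hY : hausdorff_space (coset_space (nil_lattice (N i))).
  exact/coset_hausdorff/discrete_subgroup_closed/nil_discrete.
have act_inj : injective (@act _ (nil_lattice (N i)) (nil_elt (N i))).
  by apply: (can_inj (g := act (nil_elt (N i))^-1%g)) => y; rewrite -actM mulVg act1.
have q_inj := small_factor_injective f_lift T_min hY act_inj qc qT nV VU.
have /choice[r rK] y : exists s, q i s = y.
  by have [s _ sy] := qs y Logic.I; exists s.
have qK : cancel (q i) r by move=> s; apply: q_inj; rewrite rK.
have rc := compact_bijection_inverse (@torus_compact R) hY qc qK rK.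
exact: (nil_increments f_lift T_min (nil_nilpotent (N i)) qc rc qK rK qT e0).
Qed.

(** * A two-step nilpotent Lie group acting on the torus *)

Section Smoothness.
Variables (R : realType) (V W : normedModType R).

Lemma smooth_cst (w : W) (U : set V) : smooth U (cst w : V -> W).
Proof.
move=> k; elim: k w => [|k IHk] w /=; first by move=> x _; exact: cvg_cst.
split=> [x _|v]; first exact: differentiable_cst.
rewrite (_ : 'D_v (cst w) = cst 0); first exact: IHk.
by apply/funext => x; rewrite derive_cst.
Qed.

Lemma smooth_linear (f : V -> W) (U : set V) : linear f -> continuous f -> smooth U f.
Proof.
move=> flin fc.
pose F : {linear V -> W} := HB.pack f (GRing.isLinear.Build R V W *:%R f flin).
have fd x : differentiable f x by exact: (@linear_differentiable _ _ _ F x fc).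
case=> [|k] /=; first by move=> x _; exact: fc.
split=> [x _|v]; first exact: fd.
rewrite (_ : 'D_v f = cst (f v)); first exact: smooth_cst.
by apply/funext => x; rewrite deriveE // (@diff_lin _ _ _ F x fc).
Qed.

End Smoothness.

Section DiscreteFactor.
Variables (D : discreteTopologicalType) (X Y : topologicalType).

Lemma discrete_continuous (f : D -> Y) : continuous f.
Proof.
by move=> d A /nbhs_singleton fA; rewrite nbhs_principalE; apply/principal_filterP.
Qed.

Lemma discrete_prod_nbhs (d : D) (x : X) (A : set (D * X)) :
  nbhs (d, x) A <-> nbhs x [set x' | A (d, x')].
Proof.
split=> [[[B C] /= [/nbhs_singleton Bd nC] BCA]|nA].
  by apply: filterS nC => x' Cx'; exact: (BCA (d, x')).
exists ([set d], [set x' | A (d, x')]) => /=; first by split => //; exact: discrete_set1.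
by move=> [_ x'] [/= -> ].
Qed.

Lemma discrete_prod_continuous (f : D * X -> Y) :
  (forall d, continuous (fun x => f (d, x))) -> continuous f.
Proof. by move=> fc [d x] A /fc nA; apply/discrete_prod_nbhs. Qed.

End DiscreteFactor.

(** The triple [(k, (a, b))] stands for the transformation
    [(x, y) |-> (x + a, y + k l x + b)] of the torus, and the product for the
    composition of transformations. The integer [k] makes the group disconnected
    but lets [(x, y) |-> (x + alpha, y + l x + c)] be one of its elements. *)
Definition shear_group (R : realType) (l : int) : Type :=
  (discrete_topology int * (R * R))%type.

Section ShearGroup.
Variables (R : realType) (l : int).
Local Notation G := (shear_group R l).
Implicit Types g h : G.

HB.instance Definition _ := Topological.copy G (discrete_topology int * (R * R))%type.

Definition shear_mul g h : G :=
  (g.1 + h.1 : int, (g.2.1 + h.2.1, g.2.2 + h.2.2 + (g.1 * l : int)%:~R * h.2.1)).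
Definition shear_one : G := (0 : int, (0, 0)).
Definition shear_inv g : G :=
  (- g.1 : int, (- g.2.1, - g.2.2 + (g.1 * l : int)%:~R * g.2.1)).

Lemma shear_eq g h : g.1 = h.1 -> g.2.1 = h.2.1 -> g.2.2 = h.2.2 -> g = h.
Proof. by case: g h => [k [a b]] [k' [a' b']] /= -> -> ->. Qed.

Lemma shear_mulA : associative shear_mul.
Proof.
move=> x y z; apply: shear_eq => /=; [exact: addrA|exact: addrA|].
by rewrite !intrM intrD; ring.
Qed.

Lemma shear_mul1 : left_id shear_one shear_mul.
Proof.
move=> x; apply: shear_eq => /=; [exact: add0r|exact: add0r|].
by rewrite !intrM; ring.
Qed.

Lemma shear_1mul : right_id shear_one shear_mul.
Proof. by move=> x; apply: shear_eq => /=; rewrite ?mulr0 ?addr0. Qed.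

Lemma shear_mulV : left_inverse shear_one shear_inv shear_mul.
Proof.
move=> x; apply: shear_eq => /=; [exact: addNr|exact: addNr|].
by rewrite !intrM intrN; ring.
Qed.

Lemma shear_Vmul : right_inverse shear_one shear_inv shear_mul.
Proof.
move=> x; apply: shear_eq => /=; [exact: addrN|exact: addrN|].
by rewrite !intrM; ring.
Qed.

HB.instance Definition _ := isGroup.Build G
  shear_mulA shear_mul1 shear_1mul shear_mulV shear_Vmul.

Local Notation K := (discrete_topology int).

Lemma shear_k_continuous : continuous (fun g : G => g.1 : K).
Proof. exact: fst_continuous. Qed.

Lemma shear_a_continuous : continuous (fun g : G => g.2.1 : R).
Proof.
move=> g; apply: (@continuous_comp _ _ _ (fun g : G => g.2) fst).
  exact: snd_continuous.
exact: fst_continuous.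
Qed.

Lemma shear_b_continuous : continuous (fun g : G => g.2.2 : R).
Proof.
move=> g; apply: (@continuous_comp _ _ _ (fun g : G => g.2) snd).
  exact: snd_continuous.
exact: snd_continuous.
Qed.

Lemma shear_kl_continuous : continuous (fun g : G => (g.1 * l : int)%:~R : R).
Proof.
move=> g.
apply: (@continuous_comp _ _ _ (fun g : G => g.1 : K) (fun k : K => (k * l : int)%:~R : R)).
  exact: shear_k_continuous.
exact: discrete_continuous.
Qed.

Lemma continuous_into_shear (X : topologicalType) (k : X -> K) (a b : X -> R) :
  continuous k -> continuous a -> continuous b ->
  continuous (fun x => (k x, (a x, b x)) : G).
Proof.
move=> kc ac bc x; apply: (@pair_continuous_at _ _ _ k (fun x => (a x, b x))).
  exact: kc.
by apply: pair_continuous_at; [exact: ac|exact: bc].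
Qed.

Lemma discrete_add_continuous : continuous (fun kk : K * K => kk.1 + kk.2 : K).
Proof. by apply: discrete_prod_continuous => k; exact: discrete_continuous. Qed.

Lemma shear_mul_continuous : continuous (fun gh : G * G => (gh.1 * gh.2)%g).
Proof.
have comp1 (Y : topologicalType) (p : G -> Y) :
    continuous p -> continuous (fun gh : G * G => p gh.1).
  by move=> pc gh; apply: continuous_comp; [exact: fst_continuous|exact: pc].
have comp2 (Y : topologicalType) (p : G -> Y) :
    continuous p -> continuous (fun gh : G * G => p gh.2).
  by move=> pc gh; apply: continuous_comp; [exact: snd_continuous|exact: pc].
apply: continuous_into_shear => gh.
- apply: (@continuous_comp _ _ _ (fun gh : G * G => (gh.1.1 : K, gh.2.1 : K))
                                 (fun kk : K * K => kk.1 + kk.2 : K)).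
    apply: pair_continuous_at; first exact: (comp1 _ _ shear_k_continuous).
    exact: (comp2 _ _ shear_k_continuous).
  exact: discrete_add_continuous.
- apply: cvgD; first exact: (comp1 _ _ shear_a_continuous).
  exact: (comp2 _ _ shear_a_continuous).
- apply: cvgD; last first.
    apply: cvgM; first exact: (comp1 _ _ shear_kl_continuous).
    exact: (comp2 _ _ shear_a_continuous).
  apply: cvgD; first exact: (comp1 _ _ shear_b_continuous).
  exact: (comp2 _ _ shear_b_continuous).
Qed.

Lemma shear_inv_continuous : continuous (fun g : G => (g^-1)%g).
Proof.
apply: continuous_into_shear => g.
- apply: (@continuous_comp _ _ _ (fun g : G => g.1 : K) (fun k : K => - k : K)).
    exact: shear_k_continuous.
  exact: discrete_continuous.
- by apply: cvgN; exact: shear_a_continuous.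
- apply: cvgD; first by apply: cvgN; exact: shear_b_continuous.
  by apply: cvgM; [exact: shear_kl_continuous|exact: shear_a_continuous].
Qed.

HB.instance Definition _ := isTopologicalGroup.Build G
  shear_mul_continuous shear_inv_continuous.

Lemma nbhs_shear (k : K) (a b : R) (A : set G) : nbhs ((k, (a, b)) : G) A <->
  exists2 e : R, 0 < e & forall a' b' : R, `|a' - a| < e -> `|b' - b| < e ->
    A (k, (a', b')).
Proof.
apply: iff_trans; first exact: discrete_prod_nbhs.
split=> [/nbhs_ballP[e /= e0 eA]|[e e0 eA]].
  exists e => // a' b' aa' bb'.
  by apply: (eA (a', b')); split; rewrite /ball /= distrC.
apply/nbhs_ballP; exists e => //= -[a' b'] [].
by rewrite /ball /= => aa' bb'; apply: eA; rewrite distrC.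
Qed.

Lemma shear_hausdorff : hausdorff_space G.
Proof.
move=> [k [a b]] [k' [a' b']] clgh.
pose A e (k : K) (a b : R) : set G :=
  [set g | exists a' b' : R, [/\ `|a' - a| < e, `|b' - b| < e & g = (k, (a', b'))]].
have nA e k1 a1 b1 : 0 < e -> nbhs ((k1, (a1, b1)) : G) (A e k1 a1 b1).
  by move=> e0; apply/nbhs_shear; exists e => // u v ? ?; exists u, v.
have close e : 0 < e -> [/\ k = k', `|a - a'| < 2 * e & `|b - b'| < 2 * e].
  move=> e0; have [_ [[u [v [ua vb ->]]] [u' [v' [ua' vb' [kk uu' vv']]]]]] :=
    clgh _ _ (nA e k a b e0) (nA e k' a' b' e0).
  split => //.
    have -> : a - a' = (u' - a') - (u - a) by rewrite uu'; ring.
    by apply: le_lt_trans (ler_normB _ _) _; lra.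
  have -> : b - b' = (v' - b') - (v - b) by rewrite vv'; ring.
  by apply: le_lt_trans (ler_normB _ _) _; lra.
have small (x : R) : (forall e, 0 < e -> `|x| < 2 * e) -> x = 0.
  move=> xs; apply/eqP; rewrite -normr_le0 leNgt; apply/negP => x0.
  have x20 : 0 < `|x| / 2 by rewrite divr_gt0.
  by have := xs _ x20; lra.
have [-> _ _] := close 1 ltr01.
have /eqP : a - a' = 0 by apply: small => e /close[].
have /eqP : b - b' = 0 by apply: small => e /close[].
by rewrite !subr_eq0 => /eqP -> /eqP ->.
Qed.

Lemma rational_near (x e : R) : 0 < e -> exists q : rat, `|x - ratr q| < e.
Proof.
move=> e0; have xe : x - e < x + e by lra.
have [q] := rat_in_itvoo xe.
by rewrite in_itv /= => /andP[xq qx]; exists q; rewrite ltr_norml; lra.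
Qed.

Lemma shear_second_countable : @second_countable G.
Proof.
pose B (i : int * (rat * rat * nat)) : set G :=
  [set g | exists a b : R, [/\ `|a - ratr i.2.1.1| < i.2.2.+1%:R^-1,
    `|b - ratr i.2.1.2| < i.2.2.+1%:R^-1 & g = (i.1, (a, b))]].
exists (range B); first exact: (card_le_trans (card_image_le _ _)) (countableP _).
split=> [_ [[k [[a b] n]] _ <-]|[k [a b]] A /nbhs_shear[e e0 eA]].
  rewrite openE => _ [u [v [/= ua vb ->]]]; apply/nbhs_shear.
  exists (Num.min (n.+1%:R^-1 - `|u - ratr a|) (n.+1%:R^-1 - `|v - ratr b|)).
    by rewrite lt_min !subr_gt0 ua vb.
  move=> u' v'; rewrite !lt_min => /andP[u1 _] /andP[_ v1].
  exists u', v'; split => //=.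
    by rewrite -(subrKA u) (le_lt_trans (ler_normD _ _)) // -ltrBrDr.
  by rewrite -(subrKA v) (le_lt_trans (ler_normD _ _)) // -ltrBrDr.
pose n := Num.truncn (2 / e).
have ne : n.+1%:R^-1 < e / 2.
  by rewrite -[e / 2]invrK invf_div ltf_pV2 ?posrE ?divr_gt0 // truncnS_gt.
have n0 : (0 : R) < n.+1%:R^-1 by rewrite invr_gt0.
have [p pa] := rational_near a n0; have [r rb] := rational_near b n0.
exists (B (k, ((p, r), n))).
  by split; [exists (k, ((p, r), n))|exists a, b].
move=> _ [a' [b' [/= pa' rb' ->]]]; apply: eA.
  have -> : a' - a = a' - ratr p - (a - ratr p) by ring.
  by rewrite (le_lt_trans (ler_normB _ _)) // [e]splitr ltrD // (lt_trans _ ne).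
have -> : b' - b = b' - ratr r - (b - ratr r) by ring.
by rewrite (le_lt_trans (ler_normB _ _)) // [e]splitr ltrD // (lt_trans _ ne).
Qed.

End ShearGroup.

Section ContinuousRealFunctions.
Variables (R : realType) (X : topologicalType).
Implicit Types f g : X -> R.

Lemma continuous_add f g :
  continuous f -> continuous g -> continuous (fun x => f x + g x).
Proof. by move=> fc gc x; apply: cvgD; [exact: fc|exact: gc]. Qed.

Lemma continuous_opp f : continuous f -> continuous (fun x => - f x).
Proof. by move=> fc x; apply: cvgN; exact: fc. Qed.

Lemma continuous_scale (c : R) f : continuous f -> continuous (fun x => c * f x).
Proof. by move=> fc x; apply: cvgM; [exact: cvg_cst|exact: fc]. Qed.

End ContinuousRealFunctions.

Section ShearNilsystem.
Variables (R : realType) (l : int).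
Local Notation G := (shear_group R l).
Local Notation K := (discrete_topology int).
Implicit Types (g h : G) (v : 'rV[R]_2).

(** Up to its integer component, the group is a plane; there is one chart for
    each value of that component. *)
Definition plane (a b : R) : 'rV[R]_2 :=
  a *: delta_mx 0 (0 : 'I_2) + b *: delta_mx 0 (1 : 'I_2).

Lemma plane0 a b : plane a b 0 (0 : 'I_2) = a.
Proof. by rewrite !mxE /= mulr1 mulr0 addr0. Qed.

Lemma plane1 a b : plane a b 0 (1 : 'I_2) = b.
Proof. by rewrite !mxE /= mulr1 mulr0 add0r. Qed.

Lemma planeK v : plane (v 0 0) (v 0 1) = v.
Proof.
apply/rowP => i; case: (unliftP 0 i) => [j ->|->]; last by rewrite plane0.
by rewrite (ord1 j) (_ : lift 0 0 = 1) ?plane1 //; apply/val_inj.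
Qed.

Lemma plane_linear a b a' b' (c : R) :
  plane (c * a + a') (c * b + b') = c *: plane a b + plane a' b'.
Proof. by rewrite /plane !scalerDl !scalerDr !scalerA addrACA. Qed.

Lemma continuous_into_plane (X : topologicalType) (a b : X -> R) :
  continuous a -> continuous b -> continuous (fun x => plane (a x) (b x)).
Proof.
by move=> ac bc x; apply: cvgD; (apply: cvgZ; last exact: cvg_cst); [exact: ac|exact: bc].
Qed.

Definition shear_chart_dom (k : int) : set G := [set g | g.1 = k].
Definition shear_chart_map g : 'rV[R]_2 := plane g.2.1 g.2.2.
Definition shear_chart_inv (k : int) v : G := (k, (v 0 0, v 0 1)).

Lemma shear_chart_invK k : cancel (shear_chart_inv k) shear_chart_map.
Proof. by move=> v; exact: planeK. Qed.

Lemma shear_chart_dom_open k : open (shear_chart_dom k).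
Proof.
apply: (@open_comp _ _ (fun g : G => g.1 : K) [set k]).
  by move=> g _; exact: shear_k_continuous.
exact: discrete_open.
Qed.

Lemma shear_chart_cod k : shear_chart_map @` shear_chart_dom k = setT.
Proof.
apply/seteqP; split => // v _; exists (shear_chart_inv k v) => //.
exact: shear_chart_invK.
Qed.

Lemma shear_chart_mapK k :
  {in shear_chart_dom k, cancel shear_chart_map (shear_chart_inv k)}.
Proof.
move=> [j [a b]]; rewrite inE /shear_chart_dom /= => jk.
by rewrite /shear_chart_inv /shear_chart_map plane0 plane1 -jk.
Qed.

Lemma shear_chart_map_continuous : continuous shear_chart_map.
Proof.
by apply: continuous_into_plane; [exact: shear_a_continuous|exact: shear_b_continuous].
Qed.

Lemma shear_chart_inv_continuous k : continuous (shear_chart_inv k).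
Proof.
apply: (@continuous_into_shear R l _ (cst (k : K)) (fun v => v 0 0) (fun v => v 0 1)).
- exact: cst_continuous.
- exact: coord_continuous.
- exact: coord_continuous.
Qed.

Definition shear_chart (k : int) : chart R G 2.
Proof.
apply: (@Chart R G 2 (shear_chart_dom k) shear_chart_map (shear_chart_inv k)).
- exact: shear_chart_dom_open.
- by rewrite shear_chart_cod; exact: openT.
- exact: shear_chart_mapK.
- by move=> x _; exact: shear_chart_map_continuous.
- by move=> v _; exact: shear_chart_inv_continuous.
Defined.

Lemma shear_chart_mapE k : chart_map (shear_chart k) = shear_chart_map.
Proof. by []. Qed.

Lemma shear_chart_invE k : chart_inv (shear_chart k) = shear_chart_inv k.
Proof. by []. Qed.

Lemma coord_fst_continuous (i : 'I_2) :
  continuous (fun uv : 'rV[R]_2 * 'rV[R]_2 => uv.1 0 i).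
Proof.
move=> uv; apply: (@continuous_comp _ _ _ fst (fun v : 'rV[R]_2 => v 0 i)).
  exact: fst_continuous.
exact: coord_continuous.
Qed.

Lemma coord_snd_continuous (i : 'I_2) :
  continuous (fun uv : 'rV[R]_2 * 'rV[R]_2 => uv.2 0 i).
Proof.
move=> uv; apply: (@continuous_comp _ _ _ snd (fun v : 'rV[R]_2 => v 0 i)).
  exact: snd_continuous.
exact: coord_continuous.
Qed.

(** In the charts the changes of charts, the product and the inverse are all
    linear: the only nonlinear term of the product involves the locally constant
    integer component. *)
Lemma shear_lie_group : lie_group R G.
Proof.
split; [exact: shear_hausdorff|exact: shear_second_countable|].
exists 2, (range shear_chart); split.
- by move=> g; exists (shear_chart g.1) => //; exists g.1.
- move=> _ _ [k _ <-] [k' _ <-].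
  rewrite shear_chart_invE shear_chart_mapE.
  rewrite (_ : _ \o _ = id); last by apply/funext => v; exact: shear_chart_invK.
  apply: (@smooth_linear R _ _ id); last by move=> v; exact: cvg_id.
  by [].
- move=> _ _ _ [k _ <-] [k' _ <-] [k'' _ <-] m.
  rewrite (_ : _ \o m = fun uv => plane (uv.1 0 0 + uv.2 0 0)
     (uv.1 0 1 + uv.2 0 1 + (k * l)%:~R * uv.2 0 0)); last by apply/funext.
  apply: smooth_linear.
    move=> c [u v] [u' v'] /=; rewrite -plane_linear !mxE.
    by congr plane; ring.
  have addc i := continuous_add (@coord_fst_continuous i) (@coord_snd_continuous i).
  apply: continuous_into_plane; first exact: addc.
  apply: continuous_add; first exact: addc.
  by apply: continuous_scale; exact: coord_snd_continuous.
- move=> _ _ [k _ <-] [k' _ <-] i.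
  rewrite (_ : _ \o i = fun u => plane (- u 0 0)
     (- u 0 1 + (k * l)%:~R * u 0 0)); last by apply/funext.
  apply: smooth_linear.
    by move=> c u u' /=; rewrite -plane_linear !mxE; congr plane; ring.
  have coordc j : continuous (fun u : 'rV[R]_2 => u 0 j : R).
    exact: coord_continuous.
  apply: continuous_into_plane; first exact: continuous_opp.
  by apply: continuous_add; [exact: continuous_opp|exact: continuous_scale].
Qed.

Definition vertical : set G := [set g | g.1 = 0 /\ g.2.1 = 0].

Lemma vertical_subgroup : is_subgroup vertical.
Proof.
split; first by [].
  move=> g h [g1 g2] [h1 h2]; split => /=; first by rewrite g1 h1.
  by rewrite g2 h2 addr0.
by move=> g [g1 g2]; split => /=; rewrite ?g1 ?g2 oppr0.
Qed.

Lemma vertical_commutator g h : vertical [~ g, h]%g.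
Proof. by split => /=; ring. Qed.

Lemma vertical_central g h : vertical g -> [~ g, h]%g = 1%g.
Proof.
move=> [g1 g2]; apply/eqP/commgP; apply: shear_eq => /=.
- exact: addrC.
- exact: addrC.
- by rewrite g1 g2 !intrM mul0r mulr0; ring.
Qed.

Lemma shear_nilpotent : nilpotent_step G 2.
Proof.
have low1 : lower_central 1 `<=` vertical.
  move=> g; apply; split; first exact: vertical_subgroup.
  by move=> _ [[a b] _ <-]; exact: vertical_commutator.
apply/seteqP; split => [g|_ ->]; last by have [] := lower_central_subgroup G 2.
apply; split; last by move=> _ [[a b] [/low1 va _] <-]; exact: vertical_central.
split; first by [].
  by move=> x y -> ->; rewrite mulg1.
by move=> x ->; rewrite invg1.
Qed.

(** The stabilizer of the point [(0, 0)] in the action of the group by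
    transformations of the torus. *)
Definition shear_lattice_set : set G :=
  [set g | g.2.1 \is a Num.int /\ g.2.2 \is a Num.int].

Lemma shear_lattice_subgroup : is_subgroup shear_lattice_set.
Proof.
split; first by split; rewrite /= rpred0.
  move=> g h [g1 g2] [h1 h2]; split => /=; first by rewrite rpredD.
  by rewrite !rpredD // rpredM // intr_int.
move=> g [g1 g2]; split => /=; first by rewrite rpredN.
by rewrite rpredD ?rpredN // rpredM // intr_int.
Qed.

Definition shear_lattice : subgroup G := Subgroup shear_lattice_subgroup.

Lemma shear_lattice_discrete :
  isolated (subgroup_set shear_lattice) = subgroup_set shear_lattice.
Proof.
apply/seteqP; split => g; first exact: isolatedS.
move: g => [k [a b]] Gg; split; first exact/mem_set.
exists [set h : G | exists a' b' : R, [/\ `|a' - a| < 1, `|b' - b| < 1 & h = (k, (a', b'))]].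
  by apply/nbhs_shear; exists 1 => // a' b' ? ?; exists a', b'.
have int_close (x y : R) : x \is a Num.int -> y \is a Num.int -> `|x - y| < 1 -> x = y.
  move=> xi yi xy1; have /intrP[j xyj] : x - y \is a Num.int by rewrite rpredB.
  have [j0|j0] := eqVneq j 0; first by apply/eqP; rewrite -subr_eq0 xyj j0.
  have : 1 <= `|j| by rewrite -gtz0_ge1 normr_gt0.
  by move: xy1; rewrite xyj -intr_norm ltrz1 ltNge => /negbTE ->.
apply/seteqP; split => [_ [[a' [b' [aa' bb' ->]]] [/= ai bi]]|_ ->]; last first.
  by split => //; exists a, b; rewrite !subrr normr0.
by case: Gg => /= a_int b_int; rewrite (int_close a' a) // (int_close b' b).
Qed.

Lemma cospi_shear (k k' : K) (a b a' b' : R) :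
  cospi shear_lattice ((k, (a, b)) : G) = cospi shear_lattice ((k', (a', b')) : G) <->
  tpi a b = tpi a' b'.
Proof.
pose d := a' - a; pose e : R := b' - b - (k * l)%:~R * d.
have -> : cospi shear_lattice ((k, (a, b)) : G) =
    cospi shear_lattice ((k', (a', b')) : G) <-> d \is a Num.int /\ e \is a Num.int.
  rewrite cospiP /= /shear_lattice_set /=.
  have -> : - a + a' = d by rewrite addrC.
  suff -> : - b + (k * l)%:~R * a + b' + (- k * l)%:~R * a' = e by [].
  by rewrite /e /d mulNr intrN; ring.
have kl_d : d \is a Num.int -> (k * l)%:~R * d \is a Num.int.
  by move=> di; rewrite rpredM // intr_int.
split=> [[di ei]|[/esym/cpiP di /esym/cpiP bi]].
  rewrite /tpi; congr pair; apply/esym/cpiP => //; rewrite /modZ_rel.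
  by rewrite -(subrK ((k * l)%:~R * d) (b' - b)) rpredD // kl_d.
by split=> //; rewrite /e rpredB // kl_d.
Qed.

Lemma shear_lattice_cocompact : compact [set: coset_space shear_lattice].
Proof.
pose J (v : R * R) : coset_space shear_lattice :=
  cospi shear_lattice (((0 : int), (v.1, v.2)) : G).
have -> : [set: coset_space shear_lattice] = J @` (`[0, 1] `*` `[0, 1]).
  apply/seteqP; split => // y _; have [[k [a b]] ->] := cospi_surj y.
  pose fr (x : R) : R := x - (Num.floor x)%:~R.
  have fr01 x : fr x \in `[0, 1].
    have := floor_le x; have := floorD1_gt x.
    by rewrite in_itv /= intrD /fr; lra.
  exists (fr a, fr b); first by split => /=; exact: fr01.
  by apply/cospi_shear; rewrite /tpi /fr -!rmorphN !cpi_addint.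
apply: continuous_compact; last by apply: compact_setX; exact: segment_compact.
have into : continuous (fun v : R * R => ((0 : int), (v.1, v.2)) : G).
  apply: (@continuous_into_shear _ _ _ (cst (0 : K))).
  - exact: cst_continuous.
  - exact: fst_continuous.
  - exact: snd_continuous.
apply: continuous_subspaceT => v.
apply: (@continuous_comp _ _ _ (fun v : R * R => ((0 : int), (v.1, v.2)) : G)
  (cospi shear_lattice)); first exact: into.
exact: cospi_continuous.
Qed.

Definition shear_nilsystem (tau : G) : nilsystem R 2 :=
  Nilsystem shear_lie_group shear_nilpotent shear_lattice_discrete
    shear_lattice_cocompact tau.

End ShearNilsystem.

(** * The torus is metrizable *)

(** A separate carrier, on which the topology defined by a distance does not
    compete with the product of the quotient topologies. *)
Definition metric_torus (R : realType) : Type := (circle R * circle R)%type.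

Section MetricTorus.
Variable R : realType.
Local Notation M := (metric_torus R).

HB.instance Definition _ := Choice.copy M (circle R * circle R)%type.

Definition circle_dist (z w : circle R) : R := distZ (repr z - repr w).

Lemma circle_dist_cpi x y : circle_dist (cpi x) (cpi y) = distZ (x - y).
Proof.
have reprZ u : modZ_rel (repr (cpi u : circle R)) u by apply/cpiP; rewrite /cpi reprK.
apply: distZ_modZ; have := reprZ x; have := reprZ y; rewrite /modZ_rel => yi xi.
have -> : repr (cpi x : circle R) - repr (cpi y : circle R) - (x - y) =
  (repr (cpi x : circle R) - x) - (repr (cpi y : circle R) - y) by ring.
by rewrite rpredB.
Qed.

Lemma circle_distxx z : circle_dist z z = 0.
Proof. by rewrite /circle_dist subrr distZ_int ?rpred0. Qed.

Lemma circle_dist_sym z w : circle_dist z w = circle_dist w z.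
Proof. by rewrite /circle_dist -opprB distZN. Qed.

Lemma circle_dist_triangle w z t : circle_dist z t <= circle_dist z w + circle_dist w t.
Proof. by rewrite /circle_dist -(subrKA (repr w)) distZD. Qed.

Lemma circle_dist_eq0 z w : circle_dist z w = 0 -> z = w.
Proof.
have [x ->] := cpi_surj z; have [y ->] := cpi_surj w.
by rewrite circle_dist_cpi => /distZ_eq0/cpiP.
Qed.

Definition torus_dist (s t : M) : R := circle_dist s.1 t.1 + circle_dist s.2 t.2.

Lemma torus_distxx s : torus_dist s s = 0.
Proof. by rewrite /torus_dist !circle_distxx addr0. Qed.

Lemma torus_dist_eq0 s t : torus_dist s t = 0 -> s = t.
Proof.
move/eqP; rewrite paddr_eq0 ?distZ_ge0 // => /andP[/eqP/circle_dist_eq0 e1].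
by move=> /eqP/circle_dist_eq0 e2; case: s t e1 e2 => [? ?] [? ?] /= -> ->.
Qed.

Lemma torus_dist_sym s t : torus_dist s t = torus_dist t s.
Proof. by congr (_ + _); exact: circle_dist_sym. Qed.

Lemma torus_dist_triangle t s u : torus_dist s u <= torus_dist s t + torus_dist t u.
Proof. by rewrite /torus_dist addrACA lerD // circle_dist_triangle. Qed.

HB.instance Definition _ := isMetric.Build R M
  torus_distxx torus_dist_eq0 torus_dist_sym torus_dist_triangle.

Lemma torus_ball (s t : M) (e : R) : ball s e t <-> torus_dist s t < e.
Proof. by []. Qed.

Lemma circle_dist_lt (x e : R) (z : circle R) : circle_dist (cpi x) z < e ->
  exists2 y, `|y - x| < e & z = cpi y.
Proof.
have [y ->] := cpi_surj z; rewrite circle_dist_cpi.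
have [k ->] := distZ_witness (x - y) => xyk.
exists (y + k%:~R); last by rewrite cpi_addint.
by rewrite distrC; move: xyk; congr (`|_| < _); ring.
Qed.

Lemma torus_metrizable : metrizable R (circle R * circle R)%type.
Proof.
exists M, id; split.
  move=> s A; have [x [y ->]] := tpi_surj s => /nbhs_ballP[e /= e0 eA].
  apply/nbhs_tpi; exists (e / 2); first by rewrite divr_gt0.
  move=> x' y' xx' yy'; apply: eA; apply/torus_ball.
  rewrite /torus_dist /= !circle_dist_cpi [e]splitr.
  by rewrite ltrD // (le_lt_trans (distZ_le _)) // distrC.
exists id; split => // s A; have [x [y ->]] := tpi_surj s => /nbhs_tpi[e e0 eA].
apply/nbhs_ballP; exists e => //= t /torus_ball.
rewrite /torus_dist /= => tE.
have [x' xx' t1] : exists2 x', `|x' - x| < e & t.1 = cpi x'.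
  apply: circle_dist_lt; apply: le_lt_trans tE.
  by rewrite lerDl distZ_ge0.
have [y' yy' t2] : exists2 y', `|y' - y| < e & t.2 = cpi y'.
  apply: circle_dist_lt; apply: le_lt_trans tE.
  by rewrite lerDr distZ_ge0.
by rewrite (surjective_pairing t) t1 t2; exact: eA.
Qed.

End MetricTorus.

(** * From coboundaries to nilsystems *)

Lemma homeomorphism_comp (X Y Z : topologicalType) (h : X -> Y) (k : Y -> Z) :
  homeomorphism h -> homeomorphism k -> homeomorphism (k \o h).
Proof.
move=> [hc [h' [hK Kh h'c]]] [kc [k' [kK Kk k'c]]]; split.
  by move=> x; apply: continuous_comp; [exact: hc|exact: kc].
exists (h' \o k'); split.
- by move=> x /=; rewrite kK hK.
- by move=> z /=; rewrite Kh Kk.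
- by move=> z; apply: continuous_comp; [exact: k'c|exact: h'c].
Qed.

Lemma minimal_conjugate (X Y : topologicalType) (T : X -> X) (S : Y -> Y) (h : X -> Y) :
  homeomorphism h -> (forall x, h (T x) = S (h x)) -> minimal S -> minimal T.
Proof.
move=> [hc [g [hK Kh gc]]] hT Smin x U [u Uu] oU.
have hTn n z : h (iter n T z) = iter n S (h z) by elim: n => //= n <-; rewrite hT.
have [||y [Uy [n [yE|yE]]]] := Smin (h x) (g @^-1` U).
- by exists (h u); rewrite /= hK.
- by apply: open_comp => // ? _; exact: gc.
- exists (g y); split => //; exists n; left.
  by rewrite yE -hTn hK.
- exists (g y); split => //; exists n; right.
  by apply: (can_inj hK); rewrite hTn Kh.
Qed.

Lemma constant_inverse_limit (X Y : topologicalType) (T : X -> X) (S : Y -> Y) (h : X -> Y) :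
  homeomorphism h -> (forall x, h (T x) = S (h x)) ->
  is_inverse_limit T (fun _ : nat => S) (fun _ => id).
Proof.
move=> [hc [g [hK Kh gc]]] hT; split.
  by move=> _; split => // y; exact: cvg_id.
pose L := inverse_limit (X := fun _ : nat => Y) (fun _ => id).
have LP y : L ((fun _ => y) : prod_topology (fun _ : nat => Y)) by move=> ?.
pose k x : L :=
  exist _ ((fun _ => h x) : prod_topology (fun _ : nat => Y)) (mem_set (LP (h x))).
have kE x i : set_val (k x) i = h x by [].
exists k; split; last by move=> x i; rewrite !kE hT.
have Lcst (z : L) i : set_val z i = set_val z 0%N.
  by elim: i => // i <-; exact: (set_valP z i).
split.
  apply: (@continuous_comp_initial L X (prod_topology (fun _ : nat => Y)) set_val k).
  move=> x; apply: prod_topology_cvg => i V nV.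
  exact: hc nV.
exists (fun z => g (set_val z 0%N)); split.
- by move=> x; rewrite kE hK.
- move=> z; apply: val_inj; apply: functional_extensionality_dep => i.
  by rewrite -[LHS]/(h _) Kh; exact/esym/Lcst.
- move=> z; apply: (@continuous_comp _ _ _ (fun z : L => set_val z 0%N) g).
    exact: inverse_limit_coord_continuous.
  exact: gc.
Qed.

Section AffineNilsystem.
Variables (R : realType) (l : int) (alpha c : R).
Local Notation torus := (circle R * circle R)%type.
Local Notation G := (shear_group R l).
Local Notation Y := (coset_space (shear_lattice R l)).

Definition torus_coset (s : torus) : Y :=
  cospi _ (((0 : int), (repr s.1, repr s.2)) : G).

Definition coset_torus (y : Y) : torus := tpi (repr y : G).2.1 (repr y : G).2.2.

Lemma torus_coset_tpi (k : discrete_topology int) (a b : R) :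
  torus_coset (tpi a b) = cospi _ ((k, (a, b)) : G).
Proof. by apply/cospi_shear; rewrite /tpi /cpi !reprK. Qed.

Lemma coset_torus_cospi (k : discrete_topology int) (a b : R) :
  coset_torus (cospi _ ((k, (a, b)) : G)) = tpi a b.
Proof.
rewrite /coset_torus; set g := repr _.
have : cospi (shear_lattice R l) g = cospi _ ((k, (a, b)) : G).
  by rewrite /cospi reprK.
by case: g => [k' [a' b']] /cospi_shear.
Qed.

Lemma torus_coset_homeomorphism : homeomorphism torus_coset.
Proof.
split.
  apply: torus_continuous.
  rewrite (_ : (fun v => _) = cospi (shear_lattice R l) \o
    (fun v : R * R => ((0 : int), (v.1, v.2)) : G)); last first.
    by apply/funext => v; exact: torus_coset_tpi.
  move=> v; apply: continuous_comp; last exact: cospi_continuous.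
  apply: (@continuous_into_shear _ _ _ (cst (0 : discrete_topology int))).
  - exact: cst_continuous.
  - exact: fst_continuous.
  - exact: snd_continuous.
exists coset_torus; split.
- by move=> s; have [x [y ->]] := tpi_surj s; rewrite (torus_coset_tpi 0) coset_torus_cospi.
- move=> y; have [[k [a b]] ->] := cospi_surj y.
  by rewrite coset_torus_cospi; exact: torus_coset_tpi.
apply: coset_continuous.
rewrite (_ : _ \o _ = (fun v : R * R => tpi v.1 v.2) \o (fun g : G => g.2)).
  move=> g; apply: continuous_comp; last exact: tpi_continuous.
  exact: snd_continuous.
by apply/funext => -[k [a b]] /=; rewrite coset_torus_cospi.
Qed.

Definition affine_elt : G := ((1 : int), (alpha, c)).

Lemma torus_coset_affine s :
  torus_coset (skew_product alpha (affine_lift l c) s) = act affine_elt (torus_coset s).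
Proof.
have [x [y ->]] := tpi_surj s.
rewrite (skew_tpi _ (affine_lift_lifts l c)) (torus_coset_tpi 0 x) act_cospi.
rewrite (torus_coset_tpi 1); congr cospi; apply: shear_eq => /=.
- by rewrite addr0.
- exact: addrC.
- by rewrite /affine_lift mul1r; ring.
Qed.

End AffineNilsystem.

Lemma coboundary_order_two (R : realType) (l : int) (alpha c : R) (f phi : R -> R) :
  l != 0 -> irrational alpha -> lifts l f -> lifts 0 phi ->
  (forall x, f x = l%:~R * x + phi (x + alpha) - phi x + c) ->
  system_of_order R 2 (skew_product alpha f).
Proof.
move=> l0 alpha_irr f_lift phi_lift fE.
pose S := skew_product alpha (affine_lift l c).
have S_lift := affine_lift_lifts l c.
pose P := skew_product 0 (fun x => - phi x).
have P_lift : lifts 0 (fun x => - phi x).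
  split; first by move=> x; apply: cvgN; exact: phi_lift.1.
  by move=> x; have := phi_lift.2 x; rewrite mulr0z; lra.
have P_homeo : homeomorphism P := skew_homeomorphism 0 P_lift.
have PT s : P (skew_product alpha f s) = S (P s).
  have [x [y ->]] := tpi_surj s.
  rewrite (skew_tpi _ f_lift) /P !(skew_tpi _ P_lift) /S (skew_tpi _ S_lift).
  by congr tpi; rewrite ?addr0 // fE /affine_lift; ring.
split.
- split; [exact: torus_metrizable|exact: torus_compact|exact: skew_homeomorphism f_lift].
- exact: minimal_conjugate P_homeo PT (affine_minimal c l0 alpha_irr).
exists (fun _ => shear_nilsystem (affine_elt l alpha c)), (fun _ => id).
apply: (constant_inverse_limit (h := @torus_coset R l \o P)).
  exact: homeomorphism_comp P_homeo (@torus_coset_homeomorphism R l).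
by move=> s /=; rewrite PT torus_coset_affine.
Qed.

Theorem theoremB (R : realType) (l : int) (alpha : R) (f : R -> R)
    (l_neq0 : l != 0) (alpha_irr : irrational alpha) (f_lift : lifts l f) :
  system_of_order R 2 (skew_product alpha f) <->
  exists (phi : R -> R) (c : R),
    lifts 0 phi /\
    forall x : R, f x = l%:~R * x + phi (x + alpha) - phi x + c.
Proof.
split; first exact: order_two_coboundary.
by move=> [phi [c [phi0 fE]]]; exact: coboundary_order_two fE.
Qed.
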